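(* Let $S$ be a bounded operator on $L^2(\mathbb{R}^d)$, let $1\le p<\infty$, and let $\Omega\subset\mathbb{R}^{2d}$ be measurable with $0<|\Omega|<\infty$. If $$\Lambda_{p,\Omega}(S)>\Lambda^{\mathrm{ess}}_{p,\Omega}(S),$$ then the supremum $\Lambda_{p,\Omega}(S)$ is attained, i.e., there is $f\in L^2(\mathbb{R}^d)\setminus\{0\}$ with $\|Q_Sf\|_{L^p(\Omega)}=\Lambda_{p,\Omega}(S)\|f\|_{L^2}^2$.
   Context: $L^2(\mathbb{R}^d)$ is a complex Hilbert space with inner product linear in the first entry. For $z=(x,\xi)\in\mathbb{R}^{2d}$, $\pi(z)f(y)=e^{2\pi i\xi\cdot y}f(y-x)$; for a bounded operator $S$, $\alpha_z(S)=\pi(z)S\pi(z)^*$ and $Q_Sf(z)=\langle\alpha_z(S)f,f\rangle$. The optimal concentration value is $\Lambda_{p,\Omega}(S)=\sup_{f\in L^2(\mathbb{R}^d)\setminus\{0\}}\|Q_Sf\|_{L^p(\Omega)}/\|f\|_{L^2}^2$ (finite for bounded $S$). The essential concentration value is $$\Lambda^{\mathrm{ess}}_{p,\Omega}(S)=\sup\Bigl\{\limsup_{n\to\infty}\|Q_Sf_n\|_{L^p(\Omega)}:\ \|f_n\|_{L^2}=1,\ f_n\rightharpoonup0\text{ weakly in }L^2(\mathbb{R}^d)\Bigr\}.$$ *)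

(* Defs.v *)
From HB Require Import structures.
From mathcomp Require Import all_boot all_order all_algebra.
From mathcomp Require Import generic_quotient ring_quotient.
From mathcomp Require Import all_classical all_reals all_analysis.
From mathcomp Require Import measurable_realfun complex lra.

Set Implicit Arguments.
Unset Strict Implicit.
Unset Printing Implicit Defensive.
Import Order.TTheory GRing.Theory Num.Theory.
Import numFieldNormedType.Exports.
Import Normc.

Local Open Scope classical_set_scope.
Local Open Scope ring_scope.
Local Open Scope quotient_scope.
Local Open Scope complex_scope.

Section square_integrable.
Context {d} {T : measurableType d} {R : realType}.
Variable mu : {measure set T -> \bar R}.

Definition cmeasurable (f : T -> R[i]) :=
  measurable_fun setT (fun x => complex.Re (f x)) /\
  measurable_fun setT (fun x => complex.Im (f x)).

Definition sqint : {pred T -> R[i]} := mem [set f : T -> R[i] |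
  cmeasurable f /\ mu.-integrable setT (fun x => (normc (f x) ^+ 2)%:E)].

Lemma sqr_normcE (z : R[i]) :
  normc z ^+ 2 = complex.Re z ^+ 2 + complex.Im z ^+ 2.
Proof. by case: z => a b /=; rewrite sqr_sqrtr// addr_ge0 ?sqr_ge0. Qed.

Lemma measurable_sqr_normc (f : T -> R[i]) :
  cmeasurable f -> measurable_fun setT (fun x => (normc (f x) ^+ 2)%:E).
Proof.
move=> [mR mI]; under eq_fun do rewrite sqr_normcE.
by apply/measurable_EFinP; apply: measurable_funD; apply: measurable_funX.
Qed.

Lemma sqr_normcD_le (z w : R[i]) :
  normc (z + w) ^+ 2 <= 2 * normc z ^+ 2 + 2 * normc w ^+ 2.
Proof.
rewrite !sqr_normcE; case: z w => [a b] [a' b'] /=.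
have := sqr_ge0 (a - a'); have := sqr_ge0 (b - b').
rewrite !sqrrD !sqrrN !mulrDr !mulrN !mulr_natl !mulr2n.
by set x := a ^+ 2; set y := a' ^+ 2; set p := a * a';
   set z := b ^+ 2; set w := b' ^+ 2; set q := b * b'; lra.
Qed.

Lemma sqint_submod_closed : submod_closed sqint.
Proof.
split.
  apply/mem_set; split; first by split; exact: measurable_cst.
  apply: eq_integrable (integrable0 _ _) => // x _ /=.
  by rewrite !expr0n/= addr0 sqrtr0 expr0n.
move=> a f g /set_mem[[mRf mIf] If] /set_mem[[mRg mIg] Ig]; apply/mem_set.
have m : cmeasurable (a *: f + g).
  split.
    rewrite (_ : (fun x => _) = (fun x => (complex.Re a * complex.Re (f x) -
      complex.Im a * complex.Im (f x)) + complex.Re (g x))); last first.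
      apply/funext => x; rewrite !fctE /=.
      by case: a (f x) (g x) => ? ? [? ?] [? ?].
    by apply: measurable_funD => //; apply: measurable_funB;
      exact: measurable_funM.
  rewrite (_ : (fun x => _) = (fun x => (complex.Re a * complex.Im (f x) +
    complex.Im a * complex.Re (f x)) + complex.Im (g x))); last first.
    apply/funext => x; rewrite !fctE /=.
    by case: a (f x) (g x) => ? ? [? ?] [? ?].
  by apply: measurable_funD => //; apply: measurable_funD;
    exact: measurable_funM.
split=> //.
pose h x := (2 * normc a ^+ 2 * (normc (f x) ^+ 2) + 2 * normc (g x) ^+ 2)%:E.
apply: (@le_integrable _ _ _ _ _ measurableT _ h).
- exact: measurable_sqr_normc.
- move=> x _; rewrite /h lee_fin ger0_norm ?sqr_ge0// ler_normr; apply/orP; left.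
  rewrite -mulrA -exprMn -normcM; exact: sqr_normcD_le.
- rewrite (_ : h = ((fun x => (2 * normc a ^+ 2)%:E * (normc (f x) ^+ 2)%:E) \+
                    (fun x => 2%:E * (normc (g x) ^+ 2)%:E))%E) //.
  by apply: integrableD => //; exact: integrableZl.
Qed.

HB.instance Definition _ :=
  GRing.isSubmodClosed.Build _ _ sqint sqint_submod_closed.

Record sqint_fun := SqintFun {
  sqint_val :> T -> R[i] ; sqint_valP : sqint_val \in sqint }.

HB.instance Definition _ := [isSub for sqint_val].
HB.instance Definition _ := [Choice of sqint_fun by <:].
HB.instance Definition _ := [SubChoice_isSubLmodule of sqint_fun by <:].

Definition ae_zero : {pred sqint_fun} :=
  mem [set f : sqint_fun | {ae mu, forall x, f x = 0}].

Lemma ae_zero_zmod_closed : zmod_closed ae_zero.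
Proof.
split; first by apply/mem_set; exact: aeW.
move=> f g /set_mem/= f0 /set_mem/= g0; apply/mem_set => /=.
apply: (filterS2 _ _ f0 g0) => x f0x g0x.
by rewrite /= !fctE /= f0x g0x subr0.
Qed.

Lemma ae_zeroZ (a : R[i]) f : f \in ae_zero -> a *: f \in ae_zero.
Proof.
move=> /set_mem/= f0; apply/mem_set => /=.
apply: filterS f0 => x f0x.
by rewrite /= !fctE /= f0x scaler0.
Qed.

HB.instance Definition _ :=
  GRing.isZmodClosed.Build _ ae_zero ae_zero_zmod_closed.

(* Complex L^2(mu): square-integrable functions modulo mu-a.e. equality. Every
   class of functions measurable for the completed sigma-algebra contains one
   measurable for the sigma-algebra of T, so for a Lebesgue measure on Borel sets
   this is the usual L^2. *)
Definition L2 := Quotient.quot ae_zero.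
HB.instance Definition _ := Choice.on L2.
HB.instance Definition _ := EqQuotient.on L2.
HB.instance Definition _ := GRing.Zmodule.on L2.

Definition L2scale (a : R[i]) (u : L2) : L2 := \pi_L2 (a *: repr u).

Lemma pi_L2scale a (f : sqint_fun) : L2scale a (\pi_L2 f) = \pi_L2 (a *: f).
Proof.
apply/eqP; rewrite -Quotient.idealrBE -scalerBr; apply: ae_zeroZ.
by rewrite Quotient.idealrBE reprK.
Qed.

Lemma pi_L2D (f g : sqint_fun) : \pi_L2 f + \pi_L2 g = \pi_L2 (f + g).
Proof. apply/esym.
exact (Quotient.pi_add ae_zero f g). Qed.

Fact L2scaleA a b u : L2scale a (L2scale b u) = L2scale (a * b) u.
Proof. by rewrite -[u]reprK (pi_L2scale b) !pi_L2scale scalerA. Qed.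

Fact L2scale1 : left_id 1 L2scale.
Proof. by move=> u; rewrite -[u]reprK pi_L2scale scale1r. Qed.

Fact L2scaleDr : right_distributive L2scale +%R.
Proof.
move=> a u v; rewrite -[u]reprK -[v]reprK pi_L2D !pi_L2scale pi_L2D.
by rewrite scalerDr.
Qed.

Fact L2scaleDl u : {morph L2scale^~ u : a b / a + b}.
Proof. by move=> a b; rewrite -[u]reprK !pi_L2scale pi_L2D scalerDl. Qed.

HB.instance Definition _ := GRing.Zmodule_isLmodule.Build R[i] L2
  L2scaleA L2scale1 L2scaleDr L2scaleDl.

(* Linear in the first argument. *)
Definition inner (u v : L2) : R[i] :=
  let h x := repr u x * (repr v x)^* in
  (\int[mu]_x complex.Re (h x))%R +i* (\int[mu]_x complex.Im (h x))%R.

Definition L2norm (u : L2) : R := Num.sqrt (complex.Re (inner u u)).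

(* Functionals on the Hilbert space are the inner products against its elements;
   R[i]^o carries the metric topology of R[i]. *)
Definition weak_cvg (f_ : nat -> L2) (f : L2) :=
  forall g, inner (f_ n) g @[n --> \oo] --> (inner f g : R[i]^o).

Definition bounded_op (A : L2 -> L2) :=
  exists C : R, forall f, L2norm (A f) <= C * L2norm f.

(* By nondegeneracy of inner, adjoint A g is the unique h with
   <A f, g> = <f, h> for all f whenever such an h exists, in particular for every
   bounded linear A; 0 is only a default. *)
Definition adjoint (A : L2 -> L2) (g : L2) : L2 :=
  xget 0 [set h | forall f, inner (A f) g = inner f h].

End square_integrable.

Section euclidean_lebesgue.
Context {R : realType}.

Definition tcons d (p : R * d.-tuple R) : d.+1.-tuple R := [tuple of p.1 :: p.2].

Lemma measurable_tcons d : measurable_fun setT (@tcons d).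
Proof. exact: measurable_cons. Qed.

Definition tuncons d (t : d.+1.-tuple R) : R * d.-tuple R :=
  (thead t, [tuple of behead t]).

Lemma measurable_tuncons d : measurable_fun setT (@tuncons d).
Proof.
apply: measurable_fun_pair; last exact: measurable_behead.
exact: measurable_tnth.
Qed.

Lemma tconsK d : cancel (@tcons d) (@tuncons d).
Proof. move=> [x t]; rewrite /tuncons /tcons theadE /=; congr pair; exact/val_inj. Qed.

Section leb_step.
Context d (m : {sigma_finite_measure set (d.-tuple R) -> \bar R}).

Definition leb_step : set (d.+1.-tuple R) -> \bar R :=
  pushforward (@lebesgue_measure R \x m)%E (@tcons d).

Let mpre A : measurable A -> measurable (@tcons d @^-1` A).
Proof. by move=> mA; rewrite -[X in measurable X]setTI; exact: measurable_tcons. Qed.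

Let leb_step0 : leb_step set0 = 0%E.
Proof. by rewrite /leb_step /pushforward preimage_set0 measure0. Qed.

Let leb_step_ge0 A : (0 <= leb_step A)%E.
Proof. exact: (measure_ge0 (@lebesgue_measure R \x m)%E). Qed.

Let leb_step_sigma_additive : semi_sigma_additive leb_step.
Proof.
move=> F mF tF mUF; rewrite /leb_step /pushforward preimage_bigcup.
apply: measure_semi_sigma_additive.
- by move=> n; exact: mpre.
- apply/trivIsetP => /= i j _ _ ij; rewrite -preimage_setI.
  by move/trivIsetP : tF => /(_ _ _ _ _ ij) ->//; rewrite preimage_set0.
- by rewrite -preimage_bigcup; exact: mpre.
Qed.

HB.instance Definition _ := isMeasure.Build _ _ _ leb_step
  leb_step0 leb_step_ge0 leb_step_sigma_additive.

Let leb_step_sigma_finite : sigma_finite setT leb_step.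
Proof.
have /sigma_finiteP[F [TF ndF Foo]] := sigma_finiteT (@lebesgue_measure R).
have /sigma_finiteP[G [TG ndG Goo]] := sigma_finiteT m.
exists (fun n => @tuncons d @^-1` (F n `*` G n)).
  rewrite -preimage_bigcup (_ : \bigcup_n _ = setT) ?preimage_setT//.
  rewrite -setXTT TF TG predeqE => -[x y]; split.
    by move=> [n _ []/= ? ?]; split; exists n.
  move=> [/= [n _ Fnx] [k _ Gky]]; exists (maxn n k) => //; split.
  - by move: x Fnx; exact/subsetPset/ndF/leq_maxl.
  - by move: y Gky; exact/subsetPset/ndG/leq_maxr.
move=> k; have [mFk Fkoo] := Foo k; have [mGk Gkoo] := Goo k; split.
  rewrite -[X in measurable X]setTI; apply: measurable_tuncons => //.
  exact: measurableX.
rewrite /leb_step /pushforward -comp_preimage.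
rewrite (_ : _ \o _ = id); last by apply/funext => p /=; rewrite tconsK.
rewrite preimage_id product_measure1E//.
by rewrite lte_mul_pinfty// ge0_fin_numE.
Qed.

HB.instance Definition _ := Measure_isSigmaFinite.Build _ _ _ leb_step
  leb_step_sigma_finite.

End leb_step.

(* d-dimensional Lebesgue measure on the Borel sets of R^d: iterated product of
   the one-dimensional one, transported along R * R^d -> R^(d+1). *)
Fixpoint leb (d : nat) : {sigma_finite_measure set (d.-tuple R) -> \bar R} :=
  match d with
  | 0 => (\d_[tuple] : {finite_measure set (0.-tuple R) -> \bar R})
  | d'.+1 => leb_step (leb d')
  end.

Definition tsub d (y x : d.-tuple R) : d.-tuple R :=
  [tuple tnth y i - tnth x i | i < d].

Definition tdot d (xi y : d.-tuple R) : R := \sum_(i < d) tnth xi i * tnth y i.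

Lemma measurable_tsub d (x : d.-tuple R) : measurable_fun setT (fun y => tsub y x).
Proof.
apply/measurable_fun_tnthP => i; rewrite /comp.
under eq_fun do rewrite tnth_mktuple.
by apply: measurable_funB => //; exact: measurable_tnth.
Qed.

Lemma measurable_tdot d (x : d.-tuple R) : measurable_fun setT (tdot x).
Proof.
apply: measurable_sum => i; apply: measurable_funM => //.
exact: measurable_tnth.
Qed.

Lemma tsub_tcons d u (t : d.-tuple R) (x : d.+1.-tuple R) :
  tsub [tuple of u :: t] x = tcons (u - thead x, tsub t [tuple of behead x]).
Proof.
apply: eq_from_tnth => i; rewrite tnth_mktuple.
case: (unliftP ord0 i) => [j ->|->]; last by rewrite !tnth0.
rewrite !tnthS tnth_mktuple tnth_behead; congr (_ - tnth x _).
by apply/val_inj; rewrite /= inordK ?ltnS ?ltn_ord.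
Qed.

Lemma measurable_subr (a : R) :
  measurable_fun setT (fun x : measurableTypeR R => x - a : measurableTypeR R).
Proof. exact: (measurable_funB (@measurable_id _ _ _) (@measurable_cst _ _ _ _ _ a)). Qed.

Lemma lebesgue_measureB (a : R) (A : set R) : measurable A ->
  pushforward lebesgue_measure
    (fun x : measurableTypeR R => x - a : measurableTypeR R) A =
  lebesgue_measure A.
Proof.
move=> mA; apply/esym/lebesgue_measure_unique => //=.
  exact: measurable_subr.
move=> _ _ [[u v]] _ <-; rewrite /pushforward.
rewrite (_ : _ @^-1` _ = `]u + a, v + a]%classic); last first.
  by apply/seteqP; split => r /=; rewrite !in_itv/= ltrBrDr lerBlDr.
by rewrite !lebesgue_measure_itv/= !lte_fin ltrD2r -EFinB -EFinD opprD addrACA subrr addr0.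
Qed.

Lemma ge0_integral_subr (f : R -> \bar R) (a : R) :
  measurable_fun setT f -> (forall x, 0 <= f x)%E ->
  (\int[lebesgue_measure]_x f (x - a)%R = \int[lebesgue_measure]_x f x)%E.
Proof.
move=> mf f0; transitivity (\int[pushforward lebesgue_measure
    (fun x : measurableTypeR R => (x - a)%R : measurableTypeR R)]_x f x)%E.
  by rewrite ge0_integral_pushforward//; exact: measurable_subr.
apply: eq_measure_integral => /=; first exact: measurable_subr.
move=> ? A mA _; exact: lebesgue_measureB.
Qed.

Lemma leb_translate d (x : d.-tuple R) (A : set (d.-tuple R)) : measurable A ->
  pushforward (leb d) (fun y => tsub y x) A = leb d A.
Proof.
elim: d x A => [|d IH] x A mA.
  rewrite /pushforward (_ : _ @^-1` _ = A)//.
  by apply/seteqP; split => t /=; rewrite [tsub t x]tuple0 [t]tuple0.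
rewrite /pushforward /= /leb_step /pushforward.
set B := tcons (d:=d) @^-1` A.
have mB : measurable B.
  by rewrite -[X in measurable X]setTI; exact: measurable_tcons.
rewrite -[RHS](@ge0_integral_subr _ (thead x)).
- apply: eq_integral => u _ /=.
  have mBu := measurable_xsection (u - thead x) mB.
  rewrite -[RHS](IH [tuple of behead x] _ mBu).
  rewrite /pushforward; congr (leb d _); apply/seteqP.
  by split=> t /=; rewrite /xsection/= !inE /B/= tsub_tcons.
- exact: measurable_fun_xsection.
- by move=> u; exact: measure_ge0.
Qed.

Lemma ge0_integral_tsub d (x : d.-tuple R) (f : d.-tuple R -> \bar R) :
  measurable_fun setT f -> (forall y, 0 <= f y)%E ->
  (\int[leb d]_y f (tsub y x) = \int[leb d]_y f y)%E.
Proof.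
move=> mf f0.
transitivity (\int[pushforward (leb d) (fun y => tsub y x)]_y f y)%E.
  by rewrite ge0_integral_pushforward//; exact: measurable_tsub.
apply: eq_measure_integral => /=; first exact: measurable_tsub.
by move=> ? A mA _; exact: leb_translate.
Qed.

End euclidean_lebesgue.

Section time_frequency.
Context {R : realType} {d : nat}.
Local Notation Rd := (d.-tuple R).
Local Notation H := (L2 (@leb R d)).

Definition expi (t : R) : R[i] := cos t +i* sin t.

Lemma normc_expi t : normc (expi t) = 1.
Proof. by rewrite /= cos2Dsin2 sqrtr1. Qed.

Definition tfshift_fun (z : Rd * Rd) (f : Rd -> R[i]) (y : Rd) : R[i] :=
  expi (2 * pi * tdot z.2 y) * f (tsub y z.1).

Lemma tfshift_sqint z f : f \in sqint (leb d) ->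
  tfshift_fun z f \in sqint (leb d).
Proof.
move=> /set_mem[mf intf]; apply/mem_set.
have mfx : cmeasurable (fun y => f (tsub y z.1)).
  by split; [apply: (measurableT_comp mf.1)|apply: (measurableT_comp mf.2)];
    exact: measurable_tsub.
have mt : measurable_fun setT (fun y => 2 * pi * tdot z.2 y).
  by apply: measurable_funM => //; exact: measurable_tdot.
have mc : measurable_fun setT (fun y => cos (2 * pi * tdot z.2 y)).
  by apply: measurableT_comp mt; apply: continuous_measurable_fun;
    exact: continuous_cos.
have ms : measurable_fun setT (fun y => sin (2 * pi * tdot z.2 y)).
  by apply: measurableT_comp mt; apply: continuous_measurable_fun;
    exact: continuous_sin.
have mT : cmeasurable (tfshift_fun z f).
  split.
    rewrite (_ : (fun _ => _) = (fun y =>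
      cos (2 * pi * tdot z.2 y) * complex.Re (f (tsub y z.1)) -
      sin (2 * pi * tdot z.2 y) * complex.Im (f (tsub y z.1)))).
      by apply: measurable_funB; apply: measurable_funM => //; case: mfx.
    by apply/funext => y; rewrite /tfshift_fun; case: (f _).
  rewrite (_ : (fun _ => _) = (fun y =>
    cos (2 * pi * tdot z.2 y) * complex.Im (f (tsub y z.1)) +
    sin (2 * pi * tdot z.2 y) * complex.Re (f (tsub y z.1)))).
    by apply: measurable_funD; apply: measurable_funM => //; case: mfx.
  by apply/funext => y; rewrite /tfshift_fun; case: (f _).
split=> //.
apply/integrableP; split; first exact: measurable_sqr_normc.
move/integrableP : intf => [_].
rewrite -(@ge0_integral_tsub R d z.1); last 2 first.
- by apply: measurableT_comp => //; exact: measurable_sqr_normc.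
- by move=> y; exact: abse_ge0.
by under [X in _ -> (X < _)%E]eq_integral do
  rewrite /tfshift_fun normcM normc_expi mul1r.
Qed.

(* The class does not depend on the representative: see tfshift_pi. *)
Definition tfshift (z : Rd * Rd) (u : H) : H :=
  \pi_H (SqintFun (tfshift_sqint z (sqint_valP (repr u)))).

Lemma tfshift_pi z (f : sqint_fun (leb d)) :
  tfshift z (\pi_H f) = \pi_H (SqintFun (tfshift_sqint z (sqint_valP f))).
Proof.
apply/eqP; rewrite -Quotient.idealrBE; apply/mem_set => /=.
have : repr (\pi_H f) - f \in ae_zero (mu := leb d).
  by rewrite Quotient.idealrBE reprK.
move=> /set_mem/= [N [mN N0 fN]].
exists ((fun y => tsub y z.1) @^-1` N); split.
- by rewrite -[X in measurable X]setTI; exact: measurable_tsub.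
- by rewrite -N0; exact: leb_translate.
- move=> y /= fy; apply: fN => /= f0; apply: fy.
  by move: f0; rewrite !fctE /= /tfshift_fun -mulrN -mulrDr => ->; rewrite mulr0.
Qed.

Definition opshift z (S : H -> H) : H -> H :=
  tfshift z \o S \o adjoint (tfshift z).

Definition quad_rep (S : H -> H) (f : H) (z : Rd * Rd) : R[i] :=
  inner (opshift z S f) f.

(* R^(2d) is R^d * R^d, z = (x, xi). phase_measure is the completion of the
   product measure: the measurable sets of phase_space are the
   Lebesgue-measurable subsets of R^(2d). *)
Definition leb2 : {measure set (Rd * Rd) -> \bar R} :=
  (@leb R d \x @leb R d)%E.

Definition phase_space : measurableType _ := caratheodory_type (leb2^*)%mu.

Definition phase_measure : {measure set phase_space -> \bar R} :=
  @completed_measure_extension _ _ _ leb2.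

(* The restriction f \_ Omega is 0 outside Omega. *)
Definition quad_rep_norm (p : R) (Omega : set phase_space) (S : H -> H) (f : H)
    : \bar R :=
  'N[phase_measure]_(p%:E)[(fun z => (normc (quad_rep S f z))%:E) \_ Omega].

Definition concentration p Omega (S : H -> H) : \bar R :=
  ereal_sup [set (quad_rep_norm p Omega S f * ((L2norm f ^+ 2)^-1)%:E)%E |
    f in [set f : H | f != 0]].

Definition ess_concentration p Omega (S : H -> H) : \bar R :=
  ereal_sup [set limn_esup (fun n => quad_rep_norm p Omega S (f_ n)) |
    f_ in [set f_ : nat -> H | (forall n, L2norm (f_ n) = 1) /\ weak_cvg f_ 0]].
End time_frequency.

(* Main.v *)
(** Proof idea. Put [Q(f, g)(z) = <S pi(z)^* f, pi(z)^* g>], so that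
    [Q_S f = Q(f, f)]. A normalized maximizing sequence [f_n] has, after
    extraction, a weak limit [h]; write [f_n = h + g_n] with [g_n] weakly null.
    The cross terms [Q(h, g_n) + Q(g_n, h)] are bounded and tend to [0] pointwise,
    hence in [L^p(Omega)] because [|Omega| < oo], and [|g_n|^2 -> 1 - |h|^2].
    If [|h| < 1], normalizing [g_n] gives a weakly null sequence of unit vectors,
    and Minkowski's inequality yields
    [Lambda <= Lambda |h|^2 + r (1 - |h|^2)] for some [r < Lambda], which is absurd;
    so [|h| = 1], [g_n -> 0] in norm, and [h] attains the supremum.

    Minkowski and dominated convergence need [z |-> Q(f, g)(z)] to be measurable.
    Expanding [pi(z)^* g] in an orthonormal basis reduces this to the coefficients
    [z |-> <pi(z) u, v>], which are measurable by Fubini. Such a basis exists since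
    [L^2] of a sigma-finite measure on a countably generated sigma-algebra has a
    countable total family. *)

Require Import Defs.
From mathcomp Require Import all_boot all_order all_algebra.
From mathcomp Require Import generic_quotient ring_quotient.
From mathcomp Require Import all_classical all_reals all_analysis.
From mathcomp Require Import measurable_realfun complex ring lra.
Import Order.TTheory GRing.Theory Num.Theory.
Import numFieldNormedType.Exports.
Import Normc.
Set Implicit Arguments.
Unset Strict Implicit.
Unset Printing Implicit Defensive.
Local Open Scope classical_set_scope.
Local Open Scope ring_scope.
Local Open Scope complex_scope.

(** * Modulus of complex numbers and real null sequences *)

Section complex_modulus.
Context {R : realType}.
Implicit Types z w : R[i].

Lemma normc_ge0 z : 0 <= normc z.
Proof. by case: z => a b; exact: sqrtr_ge0. Qed.

Lemma normc_conj z : normc z^*%C = normc z.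
Proof. by case: z => a b /=; rewrite sqrrN. Qed.

Lemma normc_Re z : `|complex.Re z| <= normc z.
Proof. by case: z => a b /=; rewrite -sqrtr_sqr ler_wsqrtr// lerDl sqr_ge0. Qed.

Lemma normc_Im z : `|complex.Im z| <= normc z.
Proof. by case: z => a b /=; rewrite -sqrtr_sqr ler_wsqrtr// lerDr sqr_ge0. Qed.

Lemma normc_le_ReIm z : normc z <= `|complex.Re z| + `|complex.Im z|.
Proof.
case: z => a b /=.
rewrite -[leRHS]ger0_norm ?addr_ge0// -sqrtr_sqr ler_wsqrtr// sqrrD.
rewrite !real_normK ?num_real// lerD2r lerDl mulrn_wge0 ?mulr_ge0//.
Qed.

Lemma normc_real (x : R) : normc x%:C = `|x|.
Proof. by rewrite /= expr0n addr0 sqrtr_sqr. Qed.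

Lemma conjcD z w : (z + w)^*%C = z^*%C + w^*%C.
Proof. exact: rmorphD. Qed.

Lemma conjcM z w : (z * w)^*%C = z^*%C * w^*%C.
Proof. exact: rmorphM. Qed.

Lemma conjcN z : (- z)^*%C = - z^*%C.
Proof. exact: rmorphN. Qed.

Lemma realcM (x y : R) : (x * y)%:C = x%:C * y%:C.
Proof. exact: rmorphM. Qed.

Lemma mulc_conj z : z * z^*%C = (normc z ^+ 2)%:C.
Proof.
rewrite sqr_normcE; case: z => a b /=; apply/eqP; rewrite eq_complex /=.
by apply/andP; split; apply/eqP; ring.
Qed.

Lemma ReD z w : complex.Re (z + w) = complex.Re z + complex.Re w.
Proof. by case: z w => [? ?] [? ?]. Qed.

Lemma ImD z w : complex.Im (z + w) = complex.Im z + complex.Im w.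
Proof. by case: z w => [? ?] [? ?]. Qed.

Lemma ReN z : complex.Re (- z) = - complex.Re z.
Proof. by case: z. Qed.

Lemma normcBC z w : normc (z - w) = normc (w - z).
Proof. by rewrite -normcN opprB. Qed.

Lemma le_normcD3 a b c : normc (a + b + c : R[i]) <= normc a + normc b + normc c.
Proof. by rewrite (le_trans (le_normcD _ _))// lerD2r le_normcD. Qed.

Lemma cvg0_le (a b : nat -> R) : (forall n, 0 <= a n <= b n) ->
  b @ \oo --> (0 : R) -> a @ \oo --> (0 : R).
Proof.
by move=> ab b0; apply: (squeeze_cvgr _ (cvg_cst 0) b0); exact: nearW.
Qed.

Lemma cvg0_cst_le (a : R) (b : nat -> R) : (forall n, a <= b n) ->
  b @ \oo --> (0 : R) -> a <= 0.
Proof.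
move=> ab b0; apply: (cvgr_to_ge b0); exact: nearW.
Qed.

Lemma cvg0P (a : nat -> R) : (forall n, 0 <= a n) ->
  (forall e, 0 < e -> exists N, forall n, (N <= n)%N -> a n <= e) ->
  a @ \oo --> (0 : R).
Proof.
move=> a0 h; apply/cvgr0Pnorm_le => e e0; have [N hN] := h _ e0.
by exists N => // n /= Nn; rewrite ger0_norm// hN.
Qed.

Lemma cvg0_ex (a : nat -> R) : a @ \oo --> (0 : R) ->
  forall e, 0 < e -> exists N, forall n, (N <= n)%N -> a n <= e.
Proof.
move=> /cvgr0Pnorm_le h e /h[N _ hN]; exists N => n Nn.
exact: le_trans (ler_norm _) (hN _ Nn).
Qed.

Lemma cvgr_sum (a : nat -> nat -> R) (l : nat -> R) N :
  (forall k, a k @ \oo --> l k) ->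
  (fun n => \sum_(0 <= k < N) a k n) @ \oo --> \sum_(0 <= k < N) l k.
Proof.
move=> al; elim: N => [|N IH].
  rewrite big_geq//; under eq_fun do rewrite big_geq//.
  exact: cvg_cst.
rewrite big_nat_recr//=; under eq_fun do rewrite big_nat_recr//=.
exact: cvgD.
Qed.

End complex_modulus.

(** * Inner product spaces and orthonormal expansions *)

Section inner_product.
Context {R : realType} {H : lmodType R[i]} (ip : H -> H -> R[i]).

Record inner_product : Prop := InnerProduct {
  ipDl : forall u v w, ip (u + v) w = ip u w + ip v w;
  ipZl : forall a u v, ip (a *: u) v = a * ip u v;
  ipJ : forall u v, (ip u v)^*%C = ip v u;
  ip_ge0 : forall u, 0 <= complex.Re (ip u u);
  ip_eq0 : forall u, complex.Re (ip u u) = 0 -> u = 0 }.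

Definition ip_norm u := Num.sqrt (complex.Re (ip u u)).

Definition ip_complete := forall u : nat -> H,
  (forall e, 0 < e -> exists N, forall m n,
    (N <= m)%N -> (m <= n)%N -> ip_norm (u n - u m) <= e) ->
  exists h, (fun n => ip_norm (u n - h)) @ \oo --> (0 : R).

Hypothesis ax : inner_product.

Local Notation nm := ip_norm.

Lemma ipDr u v w : ip u (v + w) = ip u v + ip u w.
Proof. by rewrite -(ipJ ax) (ipDl ax) conjcD !(ipJ ax). Qed.

Lemma ipZr a u v : ip u (a *: v) = a^*%C * ip u v.
Proof. by rewrite -(ipJ ax) (ipZl ax) conjcM !(ipJ ax). Qed.

Lemma ip0l u : ip 0 u = 0.
Proof. by rewrite -(scale0r 0) (ipZl ax) mul0r. Qed.

Lemma ip0r u : ip u 0 = 0.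
Proof. by rewrite -(ipJ ax) ip0l conjc0. Qed.

Lemma ipNl u v : ip (- u) v = - ip u v.
Proof. by rewrite -scaleN1r (ipZl ax) mulN1r. Qed.

Lemma ipNr u v : ip u (- v) = - ip u v.
Proof. by rewrite -(ipJ ax) ipNl conjcN (ipJ ax). Qed.

Lemma ipBl u v w : ip (u - v) w = ip u w - ip v w.
Proof. by rewrite (ipDl ax) ipNl. Qed.

Lemma ipBr u v w : ip u (v - w) = ip u v - ip u w.
Proof. by rewrite ipDr ipNr. Qed.

Lemma ip_addadd u v u' v' :
  ip (u + v) (u' + v') = ip u u' + ip v v' + (ip u v' + ip v u').
Proof. by rewrite (ipDl ax) !ipDr; ring. Qed.

Lemma ip_scale_scale (a : R) u v :
  ip (a%:C *: u) (a%:C *: v) = (a ^+ 2)%:C * ip u v.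
Proof. by rewrite (ipZl ax) ipZr conjc_real mulrA -realcM. Qed.

Lemma ip_suml I (r : seq I) P (F : I -> H) u :
  ip (\sum_(i <- r | P i) F i) u = \sum_(i <- r | P i) ip (F i) u.
Proof.
by elim/big_rec2: _ => [|i x y _ <-]; rewrite ?ip0l ?(ipDl ax).
Qed.

Lemma ip_sumr I (r : seq I) P (F : I -> H) u :
  ip u (\sum_(i <- r | P i) F i) = \sum_(i <- r | P i) ip u (F i).
Proof.
by elim/big_rec2: _ => [|i x y _ <-]; rewrite ?ip0r ?ipDr.
Qed.

Lemma ip_norm_ge0 u : 0 <= nm u.
Proof. exact: sqrtr_ge0. Qed.

Lemma sqr_ip_norm u : nm u ^+ 2 = complex.Re (ip u u).
Proof. by rewrite sqr_sqrtr// (ip_ge0 ax). Qed.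

Lemma ip_self u : ip u u = (nm u ^+ 2)%:C.
Proof.
have := ipJ ax u u; rewrite sqr_ip_norm; case: (ip u u) => a b [] /= bN.
by apply/eqP; rewrite eq_complex /= eqxx/=; apply/eqP; lra.
Qed.

Lemma ip_norm0 : nm 0 = 0.
Proof. by rewrite /ip_norm ip0l sqrtr0. Qed.

Lemma ip_norm_eq0 u : nm u = 0 -> u = 0.
Proof. by move=> u0; apply: (ip_eq0 ax); rewrite -sqr_ip_norm u0 expr0n. Qed.

Lemma ip_norm_gt0 u : u != 0 -> 0 < nm u.
Proof.
by move=> u0; rewrite lt0r ip_norm_ge0 andbT; apply: contra_neq u0 => /ip_norm_eq0.
Qed.

Lemma ip_normZ a u : nm (a *: u) = normc a * nm u.
Proof.
rewrite /ip_norm (ipZl ax) ipZr mulrA mulc_conj ip_self -realcM.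
by rewrite sqrtrM ?sqr_ge0// !sqrtr_sqr !ger0_norm ?normc_ge0// ?ip_norm_ge0.
Qed.

Lemma ip_normN u : nm (- u) = nm u.
Proof. by rewrite /ip_norm ipNl ipNr opprK. Qed.

Lemma ip_normBC u v : nm (u - v) = nm (v - u).
Proof. by rewrite -ip_normN opprB. Qed.

Lemma sqr_ip_normD u v :
  nm (u + v) ^+ 2 = nm u ^+ 2 + nm v ^+ 2 + 2 * complex.Re (ip u v).
Proof.
rewrite !sqr_ip_norm (ipDl ax) !ipDr !ReD -[ip v u](ipJ ax).
by case: (ip u v) => a b /=; ring.
Qed.

Lemma ip_CauchySchwarz u v : normc (ip u v) <= nm u * nm v.
Proof.
have [->|v0] := eqVneq v 0; first by rewrite ip0r ip_norm0 mulr0 normc0.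
have nv := ip_norm_gt0 v0.
(* The residual of the projection of [u] onto the line of [v] has squared norm
   [|u|^2 - (|<u, v>| / |v|)^2]. *)
have := sqr_ge0 (nm (u - (ip u v * ((nm v ^+ 2)^-1)%:C) *: v)).
rewrite sqr_ip_normD ip_normN ip_normZ normcM normc_real ipNr ipZr.
have cE z (k : R) : (z * k%:C)^*%C * z = (normc z ^+ 2 * k)%:C.
  by rewrite conjcM conjc_real mulrAC [_^*%C * _]mulrC mulc_conj -realcM.
rewrite cE /=.
rewrite ger0_norm ?invr_ge0 ?sqr_ge0//.
set c := normc _; set a := nm u; have c0 : 0 <= c by exact: normc_ge0.
rewrite (_ : _ + _ = a ^+ 2 - (c / nm v) ^+ 2); last by field; rewrite gt_eqF.
rewrite subr_ge0 ler_pXn2r ?nnegrE ?divr_ge0 ?ip_norm_ge0//.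
by rewrite ler_pdivrMr.
Qed.

Lemma ler_ip_normD u v : nm (u + v) <= nm u + nm v.
Proof.
rewrite -(@ler_pXn2r _ 2) ?nnegrE ?addr_ge0 ?ip_norm_ge0//.
have := le_trans (ler_norm _) (le_trans (normc_Re _) (ip_CauchySchwarz u v)).
by rewrite sqr_ip_normD; lra.
Qed.

Lemma cvg_ipl (u : nat -> H) h g : (fun n => nm (u n - h)) @ \oo --> (0 : R) ->
  (fun n => normc (ip (u n) g - ip h g)) @ \oo --> (0 : R).
Proof.
move=> uh; apply: (@cvg0_le _ _ (fun n => nm (u n - h) * nm g)) => [n|].
  by rewrite normc_ge0/= -ipBl ip_CauchySchwarz.
by rewrite -(mul0r (nm g)); exact: cvgMr_tmp.
Qed.

Definition bounded_linear (L : H -> R[i]) := [/\ linear_for *%R L &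
  exists2 C, 0 <= C & forall u, normc (L u) <= C * nm u].

(* Zero vectors are allowed: Gram-Schmidt leaves them in place of the vectors that
   depend on the previous ones. *)
Definition orthonormal0 (e : nat -> H) :=
  (forall j k, j != k -> ip (e j) (e k) = 0) /\
  (forall k, e k = 0 \/ nm (e k) = 1).

Definition ip_total (v : nat -> H) :=
  forall u, (forall k, ip u (v k) = 0) -> u = 0.

Section orthonormal_expansion.
Variable e : nat -> H.
Hypothesis e_on : orthonormal0 e.

Lemma sqr_ip_norm_sum (c : nat -> R[i]) m n :
  nm (\sum_(m <= k < n) c k *: e k) ^+ 2 =
  \sum_(m <= k < n) normc (c k) ^+ 2 * nm (e k) ^+ 2.
Proof.
have [mn|nm'] := leqP m n; last by rewrite !big_geq ?ip_norm0 ?expr0n 1?ltnW.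
elim: n mn => [|n IH]; first by rewrite leqn0 => /eqP->; rewrite !big_nil ip_norm0 expr0n.
rewrite leq_eqVlt => /predU1P[->|]; first by rewrite !big_geq ?ip_norm0 ?expr0n.
rewrite ltnS => mn; rewrite !big_nat_recr//= sqr_ip_normD IH//.
rewrite ip_normZ exprMn ip_suml [X in complex.Re X]big1_seq ?mulr0 ?addr0// => k.
rewrite mem_index_iota => /andP[_ /andP[_ kn]].
by rewrite (ipZl ax) ipZr e_on.1 ?mulr0// neq_ltn kn.
Qed.

Lemma gs_ip_sum (c : nat -> R[i]) n k : (k < n)%N ->
  ip (\sum_(0 <= j < n) c j *: e j) (e k) = c k * ip (e k) (e k).
Proof.
move=> kn; rewrite ip_suml (bigD1_seq k) ?mem_index_iota ?iota_uniq//=.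
by rewrite (ipZl ax) big1 ?addr0// => j jk; rewrite (ipZl ax) e_on.1 ?mulr0.
Qed.

(** The factor [ip (e k) (e k)] is 1, except when [e k = 0], and then both sides vanish. *)
Lemma ip_e_e u k : ip u (e k) * ip (e k) (e k) = ip u (e k).
Proof.
by case: (e_on.2 k) => ek; rewrite ?ek ?ip0r ?mul0r// ip_self ek expr1n mulr1.
Qed.

Definition expansion N u := \sum_(0 <= k < N) ip u (e k) *: e k.

Lemma ip_expansion_compl N u k : (k < N)%N -> ip (u - expansion N u) (e k) = 0.
Proof. by move=> kN; rewrite ipBl gs_ip_sum// ip_e_e subrr. Qed.

(** Pythagoras: the expansion is orthogonal to its residual [u - expansion N u]. *)
Lemma Bessel N u :
  \sum_(0 <= k < N) normc (ip u (e k)) ^+ 2 * nm (e k) ^+ 2 <= nm u ^+ 2.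
Proof.
rewrite -sqr_ip_norm_sum -/(expansion N u).
rewrite -[in leRHS](subrK (expansion N u) u) sqr_ip_normD.
rewrite ip_sumr [X in complex.Re X]big1_seq => [|k]; last first.
  rewrite mem_index_iota => /andP[_ kN].
  by rewrite ipZr ip_expansion_compl ?mulr0.
by rewrite mulr0 addr0 lerDr sqr_ge0.
Qed.

Hypothesis cpl : ip_complete.

(** The squared distance between two partial sums is a difference of terms of the bounded
    nondecreasing sequence [s], so the partial sums are Cauchy. *)
Lemma RieszFischer (c : nat -> R[i]) (M : R) :
  (forall N, \sum_(0 <= k < N) normc (c k) ^+ 2 * nm (e k) ^+ 2 <= M) ->
  exists h, (fun n => nm (\sum_(0 <= k < n) c k *: e k - h)) @ \oo --> (0 : R).
Proof.
move=> cM; pose s N := \sum_(0 <= k < N) normc (c k) ^+ 2 * nm (e k) ^+ 2.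
have sge m n : (m <= n)%N -> s n - s m =
    \sum_(m <= k < n) normc (c k) ^+ 2 * nm (e k) ^+ 2.
  by move=> mn; rewrite /s (@big_cat_nat _ _ _ m 0 n)//= addrAC subrr add0r.
have s_nd : nondecreasing_seq s.
  move=> m n mn; rewrite -subr_ge0 sge//; apply: sumr_ge0 => k _.
  by rewrite mulr_ge0 ?sqr_ge0.
have ub : has_ubound (range s) by exists M => _ [n _ <-]; exact: cM.
have sl := nondecreasing_cvgn s_nd ub; set l := sup _ in sl.
have s_le n : s n <= l by apply: sup_ubound => //; exists n.
apply: cpl => eps eps0.
have /cvg0_ex : (fun n => l - s n) @ \oo --> (0 : R).
  by rewrite -(subrr l); apply: cvgB => //; exact: cvg_cst.
move=> /(_ (eps ^+ 2) (exprn_gt0 _ eps0))[N hN].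
exists N => m n Nm mn.
rewrite -(@ler_pXn2r _ 2) ?nnegrE ?ip_norm_ge0// ?(ltW eps0)//.
rewrite (@big_cat_nat _ _ _ m 0 n)//= addrAC subrr add0r sqr_ip_norm_sum -sge//.
by rewrite (le_trans _ (hN _ Nm))// lerD2r.
Qed.

Lemma ip_limit_sum (c : nat -> R[i]) h k :
  (fun n => nm (\sum_(0 <= k < n) c k *: e k - h)) @ \oo --> (0 : R) ->
  ip h (e k) = c k * ip (e k) (e k).
Proof.
move=> /(cvg_ipl (e k)) hc; apply/eqP; rewrite -subr_eq0; apply/eqP/eq0_normc.
apply/eqP; rewrite eq_le normc_ge0 andbT normcBC.
(* After a shift by [k.+1] every partial sum contains the index [k], so its pairing with [e k] is
   constant in [n]. *)
have hc' : (fun n => normc (ip (\sum_(0 <= j < n + k.+1) c j *: e j) (e k) -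
    ip h (e k))) @ \oo --> (0 : R).
  by move: hc; rewrite -(cvg_shiftn k.+1).
apply: (cvg0_cst_le _ hc') => n.
by rewrite gs_ip_sum// addnS ltnS leq_addl.
Qed.

Hypothesis e_total : ip_total e.

(** Bessel's inequality makes the expansion converge; its limit has the coefficients of [u], and
    totality identifies the two. *)
Lemma cvg_expansion u :
  (fun n => nm (expansion n u - u)) @ \oo --> (0 : R).
Proof.
have [h hc] := RieszFischer (Bessel^~ u).
suff uh : u = h by move: hc; rewrite -uh.
apply/eqP; rewrite -subr_eq0; apply/eqP/e_total => k.
by rewrite ipBl (ip_limit_sum _ hc) ip_e_e subrr.
Qed.

(** The representing vector is the sum of the [(L (e k))^* *: e k], whose partial sums are the [w N]
    below. *)
Lemma Riesz (L : H -> R[i]) : bounded_linear L ->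
  exists h, forall u, L u = ip u h.
Proof.
move=> [lL [C C0 bL]].
have L0 : L 0 = 0.
  by apply: eq0_normc; apply/eqP; rewrite eq_le normc_ge0 andbT;
    have := bL 0; rewrite ip_norm0 mulr0.
have LD u v : L (u + v) = L u + L v by have := lL 1 u v; rewrite scale1r mul1r.
have LZ a u : L (a *: u) = a * L u by have := lL a u 0; rewrite L0 !addr0.
have Lsum (c : nat -> R[i]) N :
    L (\sum_(0 <= k < N) c k *: e k) = \sum_(0 <= k < N) c k * L (e k).
  by elim/big_rec2: _ => [//|k x y _ <-]; rewrite LD LZ.
have Le k : normc (L (e k)) ^+ 2 * nm (e k) ^+ 2 = normc (L (e k)) ^+ 2.
  case: (e_on.2 k) => ek; first by rewrite ek L0 normc0 expr0n/= mul0r.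
  by rewrite ek expr1n mulr1.
pose w N := \sum_(0 <= k < N) (L (e k))^*%C *: e k.
(* Since [L (w N) = |w N|^2], boundedness of [L] reads [|w N|^2 <= C |w N|]. *)
have wC N : nm (w N) <= C.
  have := bL (w N); rewrite Lsum (_ : \sum_(0 <= k < N) _ = (nm (w N) ^+ 2)%:C).
    rewrite normc_real ger0_norm ?sqr_ge0// expr2.
    have [->//|w0] := eqVneq (nm (w N)) 0.
    by rewrite ler_pM2r// lt0r w0 ip_norm_ge0.
  rewrite sqr_ip_norm_sum rmorph_sum; apply: eq_bigr => k _.
  by rewrite normc_conj Le mulrC mulc_conj.
have [|h hc] := @RieszFischer (fun k => (L (e k))^*%C) (C ^+ 2).
  move=> N; rewrite -sqr_ip_norm_sum.
  by rewrite ler_pXn2r ?nnegrE ?ip_norm_ge0//; exact: wC.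
exists h => u; apply/eqP; rewrite -subr_eq0; apply/eqP/eq0_normc.
apply/eqP; rewrite eq_le normc_ge0 andbT.
have hE k : ip (e k) h = L (e k).
  rewrite -(ipJ ax) (ip_limit_sum _ hc) conjcM conjcK (ipJ ax).
  by case: (e_on.2 k) => ek; rewrite ?ek ?L0 ?mul0r// ip_self ek expr1n mulr1.
have hu : (fun n => (C + nm h) * nm (expansion n u - u)) @ \oo --> (0 : R).
  by rewrite -(mulr0 (C + nm h)); apply: cvgMl_tmp; exact: cvg_expansion.
apply: (cvg0_cst_le _ hu) => n.
have eE : L (expansion n u) = ip (expansion n u) h.
  rewrite Lsum ip_suml; apply: eq_bigr => k _.
  by rewrite (ipZl ax) hE.
(* [L] and [ip _ h] agree on finite expansions, so their difference at [u] only sees the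
   residual. *)
have -> : L u - ip u h = ip (expansion n u - u) h - L (expansion n u - u).
  rewrite ipBl -eE -[- u]scaleN1r LD LZ; ring.
rewrite (le_trans (le_normcD _ _))// normcN mulrDl addrC lerD//.
by rewrite mulrC ip_CauchySchwarz.
Qed.

End orthonormal_expansion.
End inner_product.

(** * Weak compactness and adjoints *)

(* The limits are taken along an ultrafilter, which replaces the extraction of a
   diagonal subsequence; [phi] need not be increasing. *)
Lemma bounded_seqs_common_limit {R : realType} (z : nat -> nat -> R[i])
    (M : nat -> R) : (forall k n, normc (z k n) <= M k) ->
  exists (phi : nat -> nat) (c : nat -> R[i]), (forall n, (n <= phi n)%N) /\
    forall k, (fun n => normc (z k (phi n) - c k)) @ \oo --> (0 : R).
Proof.
move=> zM.
have [U [UU ooU]] := @ultraFilterLemma nat (\oo) _.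
(* By compactness of [[-m, m]] the image ultrafilter has a cluster point, and an ultrafilter
   converges to its cluster points: otherwise the complement of some closed ball would belong to
   it. *)
have lim1 (a : nat -> R) (m : R) : (forall n, `|a n| <= m) ->
    exists c : R, forall e : R, 0 < e -> U [set n | `|a n - c| <= e].
  move=> am; have := @segment_compact R (- m) m (a @ U) _ _.
  case.
    by apply: (@filterE _ U) => n /=; rewrite in_itv/= -ler_norml.
  move=> c [_ Uc]; exists c => e e0.
  have [//|Un] := in_ultra_setVsetC [set n | `|a n - c| <= e] UU.
  have [||x [[n nx <-] xc]] :=
      Uc (a @` ~` [set n | `|a n - c| <= e]) (ball c e).
  - by apply: (@filterS _ U _ _ _ _ Un) => n nx; exists n.
  - by apply: nbhsx_ballx.
  - by case: nx; apply: ltW; move: xc; rewrite /ball/= distrC.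
have /choice[c cP] k : exists c, forall e, 0 < e ->
    U [set n | normc (z k n - c) <= e].
  have [|x xP] := lim1 (fun n => complex.Re (z k n)) (M k).
    by move=> n; rewrite (le_trans (normc_Re _)).
  have [|y yP] := lim1 (fun n => complex.Im (z k n)) (M k).
    by move=> n; rewrite (le_trans (normc_Im _)).
  exists (x +i* y) => e e0; have e2 : 0 < e / 2 by rewrite divr_gt0.
  apply: filterS2 (xP _ e2) (yP _ e2) => n /= xn yn.
  rewrite (le_trans (normc_le_ReIm _))// [leRHS](splitr e) lerD//.
    by case: (z k n) xn => ? ?.
  by case: (z k n) yn => ? ?.
(* The tail from [N] and the finitely many closeness conditions for [k < N] all belong to [U], so
   their intersection is nonempty. *)
have /choice[phi phiP] N : exists n, (N <= n)%N /\
    forall k, (k < N)%N -> normc (z k n - c k) <= N.+1%:R^-1.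
  apply: (@filter_ex _ U); apply: filterI.
    by apply: ooU; exists N.
  have : forall K, U [set n | forall k, (k < K)%N ->
      normc (z k n - c k) <= N.+1%:R^-1].
    elim=> [|K IH]; first exact: filterE.
    apply: filterS2 IH (cP K N.+1%:R^-1 _) => [n IHn KN k|].
      by rewrite ltnS leq_eqVlt => /predU1P[->//|/IHn].
    by rewrite invr_gt0.
  exact.
exists phi, c; split=> [n|k]; first by have [] := phiP n.
(* [phi n] controls only the sequences of index below [n], so the estimate for the [k]-th one starts
   after [k]. *)
rewrite -(cvg_shiftn k.+1).
apply: (@cvg0_le _ _ (fun n => n.+1%:R^-1)); last exact: cvg_harmonic.
move=> n; have kn : (k < n + k.+1)%N by rewrite addnS ltnS leq_addl.
rewrite normc_ge0 (le_trans ((phiP _).2 _ kn))//.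
by rewrite lef_pV2 ?posrE// ler_nat ltnS leq_addr.
Qed.

Section Hilbert_separable.
Context {R : realType} {H : lmodType R[i]} (ip : H -> H -> R[i]).
Hypothesis ax : inner_product ip.
Local Notation nm := (ip_norm ip).

(** Projection onto the span of the first [N] Gram-Schmidt vectors. These are spelled out in the
    body because [gs_vec] is itself defined from this projection. *)
Fixpoint gs_proj (v : nat -> H) (N : nat) (u : H) : H :=
  if N is N'.+1 then
    let w := v N' - gs_proj v N' (v N') in
    gs_proj v N' u + ip u (((nm w)^-1)%:C *: w) *: (((nm w)^-1)%:C *: w)
  else 0.

(* Since [0^-1 = 0], this is [0] when [v N] depends on the previous vectors. *)
Definition gs_vec v N : H :=
  let w := v N - gs_proj v N (v N) in ((nm w)^-1)%:C *: w.

Lemma gs_projE v N u : gs_proj v N u = expansion ip (gs_vec v) N u.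
Proof.
rewrite /expansion; elim: N => [|N IH]; first by rewrite big_nil.
by rewrite big_nat_recr//= IH.
Qed.

(** Strong induction on the larger index [k]: in the projection subtracted from [v k], only the term
    of index [j] can pair nontrivially with [gs_vec v j], and it cancels [ip (v k) (gs_vec v j)]. *)
Lemma gs_orthonormal0 v : orthonormal0 ip (gs_vec v).
Proof.
have e01 k : gs_vec v k = 0 \/ nm (gs_vec v k) = 1.
  rewrite /gs_vec; set w := _ - _.
  have [->|w0] := eqVneq w 0; first by left; rewrite scaler0.
  right; rewrite (ip_normZ ax) normc_real ger0_norm ?invr_ge0 ?ip_norm_ge0//.
  by rewrite mulVf// gt_eqF ?(ip_norm_gt0 ax).
split=> //; suff lt k j : (j < k)%N -> ip (gs_vec v k) (gs_vec v j) = 0.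
  move=> j k; rewrite neq_ltn => /orP[|/lt//] jk.
  by rewrite -(ipJ ax) lt// conjc0.
elim/ltn_ind: k j => k IH j jk.
rewrite {1}/gs_vec (ipZl ax) gs_projE (ipBl ax) (ip_suml ax).
rewrite (bigD1_seq j) ?mem_index_iota ?iota_uniq//= big1_seq => [|i]; last first.
  rewrite mem_index_iota => /andP[ij /andP[_ ik]]; rewrite (ipZl ax).
  have [ij'|ji|ij'] := ltngtP i j; last by rewrite ij' eqxx in ij.
    by rewrite -[ip (gs_vec v i) _](ipJ ax) IH// conjc0 mulr0.
  by rewrite IH ?mulr0.
rewrite addr0 (ipZl ax) (ip_self ax (gs_vec v j)).
by case: (e01 j) => ->; rewrite ?(ip0r ax) ?mul0r ?expr1n ?mulr1 subrr mulr0.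
Qed.

(** Each [v k] is a combination of the Gram-Schmidt vectors of index at most [k]. *)
Lemma gs_total v : ip_total ip v -> ip_total ip (gs_vec v).
Proof.
move=> tv u ue; apply: tv => k.
rewrite -(subrK (gs_proj v k (v k)) (v k)) (ipDr ax) gs_projE (ip_sumr ax).
rewrite big1 ?addr0 => [|j _]; last by rewrite (ipZr ax) ue mulr0.
rewrite -gs_projE; have := ue k; rewrite /gs_vec; set w := _ - _.
have [->|w0] := eqVneq w 0; first by rewrite (ip0r ax).
rewrite (ipZr ax) conjc_real => /eqP; rewrite mulf_eq0 => /orP[|/eqP//].
by rewrite eq_complex /= eqxx andbT invr_eq0 gt_eqF ?(ip_norm_gt0 ax).
Qed.

(** The coefficients converge along a common [phi]; Bessel's inequality passes to the limits, so
    they are the coefficients of some [h]. Convergence against finite expansions extends to every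
    [g] because the [u n] are bounded. *)
Lemma weak_limit (e : nat -> H) (u : nat -> H) (M : R) :
  ip_complete ip -> orthonormal0 ip e -> ip_total ip e ->
  (forall n, nm (u n) <= M) ->
  exists phi h, (forall n, (n <= phi n)%N) /\
    forall g, (fun n => normc (ip (u (phi n) - h) g)) @ \oo --> (0 : R).
Proof.
move=> cpl e_on e_total uM.
have M0 : 0 <= M by exact: le_trans (ip_norm_ge0 _ _) (uM 0%N).
have [|phi [c [phin phic]]] := @bounded_seqs_common_limit _
    (fun k n => ip (u n) (e k)) (fun k => M * nm (e k)).
  move=> k n; rewrite (le_trans (ip_CauchySchwarz ax _ _))//.
  by rewrite ler_wpM2r ?ip_norm_ge0.
have [|h hc] := RieszFischer ax e_on cpl (c := c) (M := M ^+ 2).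
  move=> N; have : (fun n => \sum_(0 <= k < N) normc (ip (u (phi n)) (e k)) ^+ 2
      * nm (e k) ^+ 2) @ \oo --> \sum_(0 <= k < N) normc (c k) ^+ 2 * nm (e k) ^+ 2.
    apply: cvgr_sum => k.
    apply: cvgMr_tmp; rewrite expr2; under eq_fun do rewrite expr2.
    suff : (fun n => normc (ip (u (phi n)) (e k))) @ \oo --> normc (c k).
      by move=> h; exact: cvgM.
    apply/cvgrPdist_le => eps eps0.
    have /cvgr0Pnorm_le/(_ _ eps0) := phic k; apply: filterS => n.
    apply: le_trans; rewrite [leRHS]ger0_norm ?normc_ge0// ler_norml.
    rewrite lerBlDr lerNl opprB lerBlDr; apply/andP; split.
      by rewrite -[in leLHS](subrK (c k) (ip _ _)) le_normcD.
    by rewrite normcBC -[in leLHS](subrK (ip (u (phi n)) (e k)) (c k)) le_normcD.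
  move=> /cvgr_to_le; apply; apply: nearW => n.
  rewrite (le_trans (Bessel ax e_on _ _))//.
  by rewrite ler_pXn2r ?nnegrE ?ip_norm_ge0.
exists phi, h; split=> // g.
have dB n : nm (u (phi n) - h) <= M + nm h.
  by rewrite (le_trans (ler_ip_normD ax _ _))// (ip_normN ax) lerD2r.
have dP N : (fun n => normc (ip (u (phi n) - h) (expansion ip e N g))) @ \oo --> (0 : R).
  apply: (@cvg0_le _ _ (fun n => \sum_(0 <= k < N)
      normc (ip g (e k)) * normc (ip (u (phi n)) (e k) - c k))).
    move=> n; rewrite normc_ge0 (ip_sumr ax)/=.
    elim/big_ind2: _ => [|x a y b xa yb|k _]; first by rewrite normc0.
      by rewrite (le_trans (le_normcD _ _))// lerD.
    rewrite (ipZr ax) normcM normc_conj ler_wpM2l ?normc_ge0// (ipBl ax).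
    rewrite (ip_limit_sum ax e_on _ hc).
    case: (e_on.2 k) => ek.
      by rewrite ek !(ip0r ax) mulr0 subrr normc0 normc_ge0.
    by rewrite (ip_self ax) ek expr1n mulr1.
  have := @cvgr_sum R (fun k n => normc (ip g (e k)) *
    normc (ip (u (phi n)) (e k) - c k)) (fun=> 0) N.
  rewrite big1//; apply => k.
  by rewrite -(mulr0 (normc (ip g (e k)))); apply: cvgMl_tmp.
apply: cvg0P => [n|eps eps0]; first exact: normc_ge0.
(* The summand 1 keeps this divisor positive when [M] and [h] vanish. *)
have K0 : 0 < M + nm h + 1 by rewrite ltr_wpDl// addr_ge0// ip_norm_ge0.
have eps2 : 0 < eps / 2 by rewrite divr_gt0.
have [N /(_ _ (leqnn N)) PN] := cvg0_ex (cvg_expansion ax e_on cpl e_total g)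
  (divr_gt0 eps2 K0).
have [m mP] := cvg0_ex (dP N) eps2.
exists m => n /mP dn.
have -> : g = expansion ip e N g - (expansion ip e N g - g).
  by rewrite opprB addrC subrK.
rewrite (ipBr ax) (le_trans (le_normcD _ _))// normcN [leRHS](splitr eps) lerD//.
rewrite (le_trans (ip_CauchySchwarz ax _ _))//.
rewrite (le_trans (ler_pM _ _ (dB n) PN)) ?ip_norm_ge0//.
rewrite mulrCA ler_piMr ?(ltW eps2)// ler_pdivrMr// mul1r lerDl//.
Qed.

Lemma adjoint_exists (e : nat -> H) (A : H -> H) (C : R) (g : H) :
  ip_complete ip -> orthonormal0 ip e -> ip_total ip e ->
  linear A -> 0 <= C -> (forall u, nm (A u) <= C * nm u) ->
  exists h, forall u, ip (A u) g = ip u h.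
Proof.
move=> cpl e_on e_total lA C0 bA.
apply: (@Riesz _ _ _ ax e e_on cpl e_total (fun u => ip (A u) g)); split.
  by move=> a u v; rewrite lA (ipDl ax) (ipZl ax).
exists (C * nm g) => [|u]; first by rewrite mulr_ge0 ?ip_norm_ge0.
rewrite (le_trans (ip_CauchySchwarz ax _ _))// mulrAC.
by rewrite ler_wpM2r ?ip_norm_ge0.
Qed.

End Hilbert_separable.

(** * The Hilbert space L2 *)

Section L2_inner_product.
Context {d} {T : measurableType d} {R : realType}.
Variable mu : {measure set T -> \bar R}.
Local Notation H := (L2 mu).
Local Notation sqint_fun := (sqint_fun mu).
Implicit Types f g h : sqint_fun.

Definition toL2 f : H := \pi_(L2 mu)%qT f.

Lemma toL2_repr (u : H) : toL2 (repr u) = u.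
Proof. by rewrite /toL2 reprK. Qed.

Lemma toL2P f g : {ae mu, forall x, f x = g x} -> toL2 f = toL2 g.
Proof.
move=> fg; apply/eqP; rewrite -Quotient.idealrBE; apply/mem_set => /=.
by apply: filterS fg => x fgx; rewrite /= !fctE /= fgx subrr.
Qed.

Lemma repr_toL2 f : {ae mu, forall x, (repr (toL2 f) : sqint_fun) x = f x}.
Proof.
have : repr (toL2 f) - f \in ae_zero (mu := mu).
  by rewrite Quotient.idealrBE reprK.
move=> /set_mem/=; apply: filterS => x.
by rewrite /= !fctE /= => /subr0_eq.
Qed.

Lemma toL2D f g : toL2 (f + g) = toL2 f + toL2 g.
Proof. by rewrite /toL2 -pi_L2D. Qed.

Lemma toL2Z a f : toL2 (a *: f) = a *: toL2 f.
Proof. by rewrite /toL2 -pi_L2scale. Qed.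

Lemma toL2B f g : toL2 (f - g) = toL2 f - toL2 g.
Proof. by rewrite toL2D -[- g]scaleN1r toL2Z scaleN1r. Qed.

Lemma sqint_cmeasurable f : cmeasurable f.
Proof. by case: f => f /= /set_mem[]. Qed.

Lemma sqint_integrable f : mu.-integrable setT (fun x => (normc (f x) ^+ 2)%:E).
Proof. by case: f => f /= /set_mem[]. Qed.

Lemma cmeasurable_mul_conj (f g : T -> R[i]) : cmeasurable f -> cmeasurable g ->
  cmeasurable (fun x => f x * (g x)^*%C).
Proof.
move=> [mRf mIf] [mRg mIg]; split.
  rewrite (_ : (fun x => _) = (fun x => complex.Re (f x) * complex.Re (g x) +
      complex.Im (f x) * complex.Im (g x))); last first.
    by apply/funext => x; case: (f x) (g x) => ? ? [? ?] /=; ring.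
  by apply: measurable_funD; apply: measurable_funM.
rewrite (_ : (fun x => _) = (fun x => complex.Im (f x) * complex.Re (g x) -
    complex.Re (f x) * complex.Im (g x))); last first.
  by apply/funext => x; case: (f x) (g x) => ? ? [? ?] /=; ring.
by apply: measurable_funB; apply: measurable_funM.
Qed.

Lemma mul_conj_integrable f g :
  mu.-integrable setT (fun x => (complex.Re (f x * (g x)^*%C))%:E) /\
  mu.-integrable setT (fun x => (complex.Im (f x * (g x)^*%C))%:E).
Proof.
have [mR mI] := cmeasurable_mul_conj (sqint_cmeasurable f) (sqint_cmeasurable g).
have le x : normc (f x * (g x)^*%C) <= normc (f x) ^+ 2 + normc (g x) ^+ 2.
  rewrite normcM normc_conj; set a := normc _; set b := normc _.
  have := sqr_ge0 (a - b); have := sqr_ge0 a; have := sqr_ge0 b.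
  by rewrite sqrrB; lra.
have hI := integrableD measurableT (sqint_integrable f) (sqint_integrable g).
split; apply: le_integrable hI => //; try exact/measurable_EFinP.
  move=> x _; rewrite /= lee_fin [leRHS]ger0_norm ?addr_ge0 ?sqr_ge0//.
  exact: le_trans (normc_Re _) (le x).
move=> x _; rewrite /= lee_fin [leRHS]ger0_norm ?addr_ge0 ?sqr_ge0//.
exact: le_trans (normc_Im _) (le x).
Qed.

(** [inner] integrates chosen representatives; since these agree a.e. with [f] and [g], any
    representatives may be used. *)
Lemma inner_toL2 f g : inner (toL2 f) (toL2 g) =
  (\int[mu]_x complex.Re (f x * (g x)^*%C))%R +i*
  (\int[mu]_x complex.Im (f x * (g x)^*%C))%R.
Proof.
have ae : {ae mu, forall x, (repr (toL2 f) : sqint_fun) x *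
    ((repr (toL2 g) : sqint_fun) x)^*%C = f x * (g x)^*%C}.
  by apply: filterS2 (repr_toL2 f) (repr_toL2 g) => x -> ->.
have [mR mI] := cmeasurable_mul_conj (sqint_cmeasurable f) (sqint_cmeasurable g).
have [mR' mI'] := cmeasurable_mul_conj (sqint_cmeasurable (repr (toL2 f)))
  (sqint_cmeasurable (repr (toL2 g))).
rewrite /inner; congr Complex; congr fine; apply: ae_eq_integral => //;
  try exact/measurable_EFinP.
  by apply: filterS ae => x e _; congr EFin; rewrite -e.
by apply: filterS ae => x e _; congr EFin; rewrite -e.
Qed.

Lemma sqr_normc_Re (z : R[i]) : complex.Re (z * z^*%C) = normc z ^+ 2.
Proof. by rewrite mulc_conj. Qed.

Lemma sqr_ip_norm_toL2 f :
  (complex.Re (inner (toL2 f) (toL2 f)))%:E = (\int[mu]_x (normc (f x) ^+ 2)%:E)%E.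
Proof.
rewrite inner_toL2 /= fineK; last first.
  exact: integrable_fin_num (mul_conj_integrable f f).1.
by apply: eq_integral => x _; rewrite sqr_normc_Re.
Qed.

Lemma inner_L2 : inner_product (@inner d T R mu).
Proof.
have Re_int f g := (mul_conj_integrable f g).1.
have Im_int f g := (mul_conj_integrable f g).2.
split.
- move=> u v w; rewrite -(toL2_repr u) -(toL2_repr v) -(toL2_repr w).
  rewrite -toL2D !inner_toL2; apply/eqP; rewrite eq_complex /=.
  rewrite -(RintegralD measurableT (Re_int _ _) (Re_int _ _)).
  rewrite -(RintegralD measurableT (Im_int _ _) (Im_int _ _)).
  apply/andP; split; apply/eqP; apply: eq_Rintegral => x _.
    by rewrite !fctE mulrDl ReD.
  by rewrite !fctE mulrDl ImD.
- move=> a u v; rewrite -(toL2_repr u) -(toL2_repr v).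
  rewrite -toL2Z !inner_toL2; apply/eqP; case: a => a b; rewrite eq_complex /=.
  have ReZ r := integrableZl measurableT r (Re_int (repr u) (repr v)).
  have ImZ r := integrableZl measurableT r (Im_int (repr u) (repr v)).
  rewrite -!(RintegralZl _ measurableT (Re_int _ _)).
  rewrite -!(RintegralZl _ measurableT (Im_int _ _)).
  rewrite -(RintegralB measurableT (ReZ a) (ImZ b)).
  rewrite -(RintegralD measurableT (ImZ a) (ReZ b)).
  apply/andP; split; apply/eqP; apply: eq_Rintegral => x _; rewrite !fctE /=.
    by case: (repr u x) (repr v x) => ? ? [? ?] /=; ring.
  by case: (repr u x) (repr v x) => ? ? [? ?] /=; ring.
- move=> u v; rewrite /inner /=; apply/eqP; rewrite eq_complex /=.
  apply/andP; split; apply/eqP.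
    apply: eq_Rintegral => x _.
    by case: (repr u x) (repr v x) => ? ? [? ?] /=; ring.
  rewrite -mulN1r -(RintegralZl _ measurableT (Im_int _ _)).
  apply: eq_Rintegral => x _.
  by case: (repr u x) (repr v x) => ? ? [? ?] /=; ring.
- move=> u; rewrite /inner /=; apply: Rintegral_ge0 => x _.
  by rewrite sqr_normc_Re sqr_ge0.
- move=> u; rewrite -(toL2_repr u) => u0; have {u0} := congr1 EFin u0.
  rewrite sqr_ip_norm_toL2 => u0; rewrite (_ : 0 = toL2 0); last first.
    by rewrite -(scale0r (0 : sqint_fun)) toL2Z scale0r.
  apply: toL2P; have := u0.
  under eq_integral do rewrite -[(_ ^+ 2)%:E]gee0_abs ?lee_fin ?sqr_ge0//.
  move=> {}u0; have := (ae_eq_integral_abs mu measurableT (measurable_sqr_normc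
    (sqint_cmeasurable (repr u)))).1 u0; apply: filterS => x /(_ I) [/eqP].
  by rewrite sqrf_eq0 => /eqP/eq0_normc ->.
Qed.

Lemma sqr_L2norm f : (ip_norm (@inner d T R mu) (toL2 f) ^+ 2)%:E =
  (\int[mu]_x (normc (f x) ^+ 2)%:E)%E.
Proof. by rewrite (sqr_ip_norm inner_L2) sqr_ip_norm_toL2. Qed.

End L2_inner_product.

(** The telescoping series of [a] converges absolutely by comparison with a geometric series. *)
Lemma cvg_geometric_increments {R : realType} (a : nat -> R) (M : R) :
  (forall k, `|a k.+1 - a k| <= M * 2^-1 ^+ k) -> cvgn a.
Proof.
move=> aM; have M0 : 0 <= M.
  by have := aM 0%N; rewrite expr0 mulr1; exact: le_trans.
have cs : cvgn (series (telescope a)).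
  apply: normed_cvg; apply: (@series_le_cvg _ _ (geometric M 2^-1)) => //.
  - by move=> n; exact: normr_ge0.
  - by move=> n; rewrite /geometric/= mulr_ge0// exprn_ge0// invr_ge0.
  - by apply: is_cvg_geometric_series; rewrite ger0_norm// invf_lt1// ltr1n.
rewrite (_ : a = (fun n => a 0%N + series (telescope a) n)).
  by apply: is_cvgD => //; exact: is_cvg_cst.
by apply/funext => n; exact: eq_sum_telescope.
Qed.

Lemma limn_einf_le {R : realType} (v : nat -> \bar R) (l : \bar R) K :
  (forall n, (K <= n)%N -> v n <= l)%E -> (limn_einf v <= l)%E.
Proof.
move=> vl; rewrite limn_einf_lim; apply: lime_le; first exact: is_cvg_einfs.
apply: nearW => n; apply: (@le_trans _ _ (v (maxn n K))).
  by apply: ereal_inf_lbound; exists (maxn n K) => //=; rewrite leq_maxl.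
by apply: vl; rewrite leq_maxr.
Qed.

Lemma limn_einf_sup_EFin {R : realType} (a : nat -> R) (l : R) : a @ \oo --> l ->
  limn_einf (fun n => (a n)%:E) = l%:E /\ limn_esup (fun n => (a n)%:E) = l%:E.
Proof.
move=> al; have ale : (fun n => (a n)%:E) @ \oo --> l%:E.
  by apply: cvg_EFin => //; exact: nearW.
by have [] := cvg_limn_einf_sup ale.
Qed.

(** * Completeness of L2 *)

Section L2_complete.
Context {d} {T : measurableType d} {R : realType}.
Variable mu : {measure set T -> \bar R}.
Local Notation nm := (ip_norm (@inner d T R mu)).
Local Notation sqint_fun := (sqint_fun mu).

Lemma sqint_normc_cvg (f : nat -> sqint_fun) :
  (forall k, nm (toL2 (f k.+1) - toL2 (f k)) <= (8 ^+ k.+1)^-1) ->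
  {ae mu, forall x, cvgn (fun k => complex.Re (f k x)) /\
                    cvgn (fun k => complex.Im (f k x))}.
Proof.
(* [sum_k 4^k |f_(k+1) - f_k|^2] has finite integral, so it is finite a.e. and
   [|f_(k+1) - f_k| = O(2^-k)] there. *)
move=> fk; pose D k x : \bar R := (4 ^+ k * normc (f k.+1 x - f k x) ^+ 2)%:E.
have mD k : measurable_fun setT (D k).
  rewrite /D (_ : (fun x => _) = (fun x => (4 ^+ k)%:E *
    (normc ((f k.+1 - f k : sqint_fun) x) ^+ 2)%:E)%E) //.
  apply: emeasurable_funM => //.
  exact: measurable_sqr_normc (sqint_cmeasurable _).
have D0 k x : (0 <= D k x)%E by rewrite lee_fin mulr_ge0 ?sqr_ge0// exprn_ge0.
(* This form of the bound fits [epsilon_trick0], by which the integrals sum to at most 1. *)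
have ID k : (\int[mu]_x D k x <= (1 / (2 ^ k.+1)%:R)%:E)%E.
  rewrite (_ : (\int[mu]_x D k x = (4 ^+ k)%:E * \int[mu]_x
    (normc ((f k.+1 - f k : sqint_fun) x) ^+ 2)%:E)%E); last first.
    rewrite -ge0_integralZl_EFin ?exprn_ge0// => [x _|].
      by rewrite lee_fin sqr_ge0.
    exact: measurable_sqr_normc (sqint_cmeasurable _).
  rewrite -sqr_L2norm toL2B -EFinM lee_fin.
  apply: (@le_trans _ _ (4 ^+ k * (8 ^+ k.+1)^-1)).
    rewrite ler_wpM2l ?exprn_ge0// (le_trans _ (fk k))// expr2.
    rewrite ler_piMl ?ip_norm_ge0// (le_trans (fk k))//.
    by rewrite invf_le1 ?exprn_gt0// exprn_ege1// ler1n.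
  rewrite div1r natrX (_ : 8 = 4 * 2 :> R); last by ring.
  rewrite exprMn invfM mulrA ler_piMl ?invr_ge0 ?exprn_ge0//.
  by rewrite ler_pdivrMr ?exprn_gt0// mul1r exprS ler_peMl ?exprn_ge0// ler1n.
pose G x := (\sum_(k <oo) D k x)%E.
have G0 x : (0 <= G x)%E by apply: nneseries_ge0 => *; exact: D0.
have IG : mu.-integrable setT G.
  apply/integrableP; split.
    by apply: ge0_emeasurable_sum => // k x _ _; exact: D0.
  under eq_integral do rewrite gee0_abs//.
  rewrite integral_nneseries//.
  apply: (@le_lt_trans _ _ 1%:E); last exact: ltry.
  apply: le_trans (epsilon_trick0 xpredT ler01).
  apply: lee_nneseries => [k _ _|k _]; last exact: ID.
  by apply: integral_ge0 => x _; exact: D0.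
apply: filterS (integrable_ae measurableT IG) => x /(_ I) Gx.
(* Adding 1 gives [g <= g ^+ 2], so the bound [g] on [4 ^ k] times the squared increment yields
   [g * 2^-1 ^+ k] on the increment itself. *)
pose g := fine (G x) + 1; have g1 : 1 <= g by rewrite lerDr fine_ge0.
have g0 : 0 <= g by exact: le_trans g1.
have le k : normc (f k.+1 x - f k x) <= g * 2^-1 ^+ k.
  rewrite -(@ler_pXn2r _ 2) ?nnegrE ?normc_ge0 ?mulr_ge0 ?exprn_ge0 ?invr_ge0//.
  have Dg : 4 ^+ k * normc (f k.+1 x - f k x) ^+ 2 <= g.
    rewrite -lee_fin -/(D k x) EFinD fineK//.
    apply: (@le_trans _ _ (G x)); last by rewrite leeDl// lee01.
    rewrite /G (nneseriesD1 (n := k))//.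
    by apply: leeDl; apply: nneseries_ge0 => *; exact: D0.
  rewrite exprMn -exprM mulnC exprM (_ : 2^-1 ^+ 2 = 4^-1 :> R); last by field.
  rewrite exprVn ler_pdivlMr ?exprn_gt0// mulrC (le_trans Dg)//.
  by rewrite expr2 ler_peMl.
split; apply: (@cvg_geometric_increments _ _ g) => k; apply: le_trans (le k).
  rewrite (_ : _ - _ = complex.Re (f k.+1 x - f k x)) ?normc_Re//.
  by rewrite ReD ReN.
rewrite (_ : _ - _ = complex.Im (f k.+1 x - f k x)) ?normc_Im//.
by rewrite ImD; case: (f k x).
Qed.

(** A subsequence with fast decreasing increments converges a.e.; Fatou's lemma then bounds the
    distance from every late term of the whole sequence to the pointwise limit. *)
Lemma L2_complete : ip_complete (@inner d T R mu).
Proof.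
move=> u cu.
have /choice[N NP] k : exists N, forall m n, (N <= m)%N -> (m <= n)%N ->
    nm (u n - u m) <= (8 ^+ k.+1)^-1.
  by apply: cu; rewrite invr_gt0 exprn_gt0.
(* Cumulative sums make [phi] nondecreasing while it dominates both [k] and [N k]. *)
pose phi k := (\sum_(0 <= j < k.+1) maxn j (N j))%N.
have phiS k : (phi k <= phi k.+1)%N by rewrite /phi [leqRHS]big_nat_recr//= leq_addr.
have phimax k : (maxn k (N k) <= phi k)%N by rewrite /phi big_nat_recr//= leq_addl.
pose f k : sqint_fun := repr (u (phi k)).
have fk k : nm (toL2 (f k.+1) - toL2 (f k)) <= (8 ^+ k.+1)^-1.
  rewrite !toL2_repr; apply: NP => //.
  exact: leq_trans (leq_maxr _ _) (phimax k).
have fcvg := sqint_normc_cvg fk.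
(* An upper limit is measurable on the whole space and equals the limit wherever the sequence
   converges; [fine] replaces infinite values by 0. *)
pose gR x := fine (limn_esup (fun k => (complex.Re (f k x))%:E)).
pose gI x := fine (limn_esup (fun k => (complex.Im (f k x))%:E)).
pose g x := gR x +i* gI x.
have mRe k : measurable_fun setT (fun x => complex.Re (f k x)).
  exact: (sqint_cmeasurable (f k)).1.
have mIm k : measurable_fun setT (fun x => complex.Im (f k x)).
  exact: (sqint_cmeasurable (f k)).2.
have mg : cmeasurable g.
  have meR := @measurable_fun_limn_esup _ _ _ setT
    (fun k x => (complex.Re (f k x))%:E) (fun k => (measurable_EFinP _ _).2 (mRe k)).
  have meI := @measurable_fun_limn_esup _ _ _ setT
    (fun k x => (complex.Im (f k x))%:E) (fun k => (measurable_EFinP _ _).2 (mIm k)).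
  by split; [exact: (measurableT_comp (@fine_measurable R _ measurableT) meR)
            |exact: (measurableT_comp (@fine_measurable R _ measurableT) meI)].
have gcvg : {ae mu, forall x (w : R[i]),
    limn_einf (fun k => (normc (w - f k x) ^+ 2)%:E) = (normc (w - g x) ^+ 2)%:E}.
  apply: filterS fcvg => x [cR cI] w.
  have gRE : gR x = limn (fun k => complex.Re (f k x)).
    by rewrite /gR (limn_einf_sup_EFin cR).2.
  have gIE : gI x = limn (fun k => complex.Im (f k x)).
    by rewrite /gI (limn_einf_sup_EFin cI).2.
  rewrite -gRE in cR; rewrite -gIE in cI.
  apply: (limn_einf_sup_EFin _).1.
  have E z : normc (w - z) ^+ 2 =
      (complex.Re w - complex.Re z) ^+ 2 + (complex.Im w - complex.Im z) ^+ 2.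
    by rewrite sqr_normcE; case: w z => ? ? [? ?].
  under eq_fun do rewrite E; rewrite E.
  by apply: cvgD; under eq_fun do rewrite expr2; rewrite expr2; apply: cvgM;
    apply: cvgB => //; exact: cvg_cst.
have mdiff (w v : T -> R[i]) : cmeasurable w -> cmeasurable v ->
    measurable_fun setT (fun x => (normc (w x - v x) ^+ 2)%:E).
  move=> mw mv; apply: measurable_sqr_normc; split.
    under eq_fun do rewrite ReD ReN.
    by apply: measurable_funB; [exact: mw.1|exact: mv.1].
  rewrite (_ : (fun x => _) = (fun x => complex.Im (w x) - complex.Im (v x))).
    by apply: measurable_funB; [exact: mw.2|exact: mv.2].
  by apply/funext => x; rewrite ImD; case: (v x).
(* Fatou's lemma: the integral is at most the lower limit of [|u m - u (phi n)|^2], and [n <= phi n]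
   puts [phi n] beyond [m] as soon as [m <= n]. *)
have bound m e : 0 <= e ->
    (forall n, (m <= n)%N -> nm (u n - u m) <= e) ->
    (\int[mu]_x (normc (repr (u m) x - g x) ^+ 2)%:E <= (e ^+ 2)%:E)%E.
  move=> e0 um; pose w : sqint_fun := repr (u m).
  have mw := sqint_cmeasurable w.
  have mh k : measurable_fun setT (fun x => (normc (w x - f k x) ^+ 2)%:E).
    exact: mdiff mw (sqint_cmeasurable (f k)).
  rewrite (_ : (\int[mu]_x _ = \int[mu]_x limn_einf
      (fun k => (normc (w x - f k x) ^+ 2)%:E))%E); last first.
    apply: ae_eq_integral => //; first exact: mdiff.
      apply: measurableT_comp => //; apply: measurable_fun_limn_esup => k.
      exact: measurableT_comp.
    by apply: filterS gcvg => x gx _; rewrite gx.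
  apply: le_trans (fatou mu measurableT mh _) _.
    by move=> k x _; rewrite lee_fin sqr_ge0.
  apply: (@limn_einf_le _ _ _ m) => n mn.
  rewrite (_ : (\int[mu]_x _ = \int[mu]_x
    (normc ((w - f n : sqint_fun) x) ^+ 2)%:E)%E) //.
  rewrite -sqr_L2norm toL2B !toL2_repr lee_fin.
  rewrite ler_pXn2r ?nnegrE ?ip_norm_ge0// (ip_normBC (inner_L2 mu)) um//.
  exact: leq_trans mn (leq_trans (leq_maxl _ _) (phimax n)).
have [m0 m0P] := cu 1 ltr01.
(* Write [g = w - (w - g)] with [w] representing [u m0]; the difference is square-integrable by
   [bound] with [e = 1]. *)
have sg : g \in sqint mu.
  pose w : sqint_fun := repr (u m0).
  have wg : (fun x => w x - g x) \in sqint mu.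
    apply/mem_set; split.
      have mw := sqint_cmeasurable w; split.
        under eq_fun do rewrite ReD ReN.
        by apply: measurable_funB; [exact: mw.1|exact: mg.1].
      rewrite (_ : (fun x => _) = (fun x => complex.Im (w x) - complex.Im (g x))).
        by apply: measurable_funB; [exact: mw.2|exact: mg.2].
      by apply/funext => x; rewrite ImD; case: (g x).
    apply/integrableP; split; first exact: mdiff (sqint_cmeasurable w) mg.
    under eq_integral do rewrite gee0_abs ?lee_fin ?sqr_ge0//.
    apply: le_lt_trans (bound m0 1 ler01 _) (ltry _) => n mn.
    exact: m0P.
  rewrite (_ : g = (w : T -> R[i]) - (fun x => w x - g x)).
    by apply: rpredB => //; exact: sqint_valP.
  by apply/funext => x; rewrite !fctE opprB addrC subrK.
exists (toL2 (SqintFun sg)); apply: cvg0P => [n|e e0]; first exact: ip_norm_ge0.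
have [K KP] := cu e e0; exists K => n Kn.
rewrite -(@ler_pXn2r _ 2) ?nnegrE ?ip_norm_ge0 ?(ltW e0)//.
rewrite -lee_fin -[u n]toL2_repr -toL2B sqr_L2norm.
by apply: bound (ltW e0) _ => k nk; exact: KP.
Qed.

End L2_complete.

(** * A countable total family in L2 *)

Section L2_separable.
Context {d} {T : measurableType d} {R : realType}.

(** The sets [A] over which [h] has zero integral on [A] intersected with [B] form a Dynkin system
    containing the pi-system [G]; an integrable function with zero integral over every measurable
    subset of [B] vanishes a.e. there. *)
Lemma integral_pi_system_eq0 (mu : {measure set T -> \bar R})
    (G : set (set T)) (h : T -> \bar R) (B : set T) :
  @measurable _ T = <<s G >> -> setI_closed G -> measurable B ->
  mu.-integrable B h -> (\int[mu]_(x in B) h x = 0)%E ->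
  (forall A, G A -> \int[mu]_(x in A `&` B) h x = 0)%E ->
  ae_eq mu B h (cst 0%E).
Proof.
move=> mG GI mB hB B0 G0.
have hI A : measurable A -> mu.-integrable (A `&` B) h.
  by move=> mA; apply: (integrableS mB _ _ hB); [exact: measurableI|exact: subIsetr].
have all0 A : measurable A -> (\int[mu]_(x in A `&` B) h x = 0)%E.
  rewrite mG; move: A; apply: (dynkin_induction mG GI) => //.
  - by rewrite setTI.
  - move=> A mA A0; have := B0; rewrite -[in X in X -> _](setTI B) -(setUv A) setIUl.
    rewrite integral_setU ?A0 ?add0e//.
    + exact: measurableI.
    + by apply: measurableI => //; exact: measurableC.
    + rewrite -setIUl setUv setTI; exact: measurable_int hB.
    + apply/disj_setPS => x [[Ax _] [nAx _]]; exact: nAx.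
  - move=> F mF tF F0; rewrite setI_bigcupl integral_bigcup.
    + by apply: eseries0 => k _ _; exact: F0.
    + exact: trivIset_setIr.
    + by move=> k; exact: measurableI.
    + by rewrite -setI_bigcupl; apply: hI; exact: bigcupT_measurable.
apply: integral_ae_eq => // E EB mE.
by rewrite -(setIidl EB) all0// integral_cst// ?mul0e//; exact: measurableI.
Qed.

Section finite_measure_sets.
Variable mu : {measure set T -> \bar R}.
Local Notation sqint_fun := (sqint_fun mu).

Lemma sqint_integrable_fin (f : sqint_fun) (A : set T) :
  measurable A -> (mu A < +oo)%E ->
  mu.-integrable A (fun x => (complex.Re (f x))%:E) /\
  mu.-integrable A (fun x => (complex.Im (f x))%:E).
Proof.
move=> mA Aoo; have [mR mI] := sqint_cmeasurable f.
have le x : normc (f x) <= normc (f x) ^+ 2 + 1.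
  have := sqr_ge0 (normc (f x) - 1); have := sqr_ge0 (normc (f x)).
  by rewrite sqrrB !mulr1 expr1n; lra.
have hI : mu.-integrable A (fun x => ((normc (f x) ^+ 2)%:E + 1%:E)%E).
  apply: integrableD => //.
    by apply: (integrableS measurableT mA _ (sqint_integrable f)); exact: subsetT.
  apply/integrableP; split; first exact: measurable_cst.
  by under eq_integral do rewrite abse1; rewrite integral_cst// mul1e.
split; apply: le_integrable hI => //.
- by apply/measurable_EFinP; exact: measurable_funTS.
- move=> x _; rewrite /= lee_fin [leRHS]ger0_norm ?addr_ge0 ?sqr_ge0//.
  exact: le_trans (normc_Re _) (le x).
- by apply/measurable_EFinP; exact: measurable_funTS.
- move=> x _; rewrite /= lee_fin [leRHS]ger0_norm ?addr_ge0 ?sqr_ge0//.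
  exact: le_trans (normc_Im _) (le x).
Qed.

(** The vector is the class of the indicator of [A], square-integrable because [A] has finite
    measure. *)
Lemma inner_indic (A : set T) : measurable A -> (mu A < +oo)%E ->
  exists v : L2 mu, forall f : sqint_fun, inner (toL2 f) v =
    (\int[mu]_(x in A) complex.Re (f x))%R +i*
    (\int[mu]_(x in A) complex.Im (f x))%R.
Proof.
move=> mA Aoo; pose g x : R[i] := (\1_A x)%:C.
have sg : g \in sqint mu.
  apply/mem_set; split; first by split; [exact: measurable_indic|exact: measurable_cst].
  rewrite (_ : (fun _ => _) = EFin \o \1_A); last first.
    apply/funext => x; rewrite /g normc_real real_normK ?num_real//= indicE.
    by case: (x \in A); rewrite ?expr1n// expr0n.
  apply/integrableP; split; first by apply/measurable_EFinP; exact: measurable_indic.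
  under eq_integral => x _.
    rewrite /= ger0_norm; last by rewrite indicE.
    over.
  by rewrite integral_indic// setIT.
exists (toL2 (SqintFun sg)) => f; rewrite inner_toL2 /=.
rewrite [X in _ = X +i* _]Rintegral_mkcond [X in _ = _ +i* X]Rintegral_mkcond.
congr Complex; apply: eq_Rintegral => x _; rewrite /g patchE indicE;
  by case: (x \in A); case: (f x) => a b /=;
    rewrite !(oppr0, mulr0, mulr1, subr0, addr0, add0r).
Qed.

End finite_measure_sets.

(** The family consists of the indicators of finite intersections of generators, cut by the
    finite-measure sets [F n] that cover the space. A function orthogonal to all of them vanishes
    a.e. on each [F n]. *)
Lemma L2_separable (mu : {sigma_finite_measure set T -> \bar R})
    (G : nat -> set T) : @measurable _ T = <<s range G >> ->
  exists v : nat -> L2 mu, ip_total (@inner d T R mu) v.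
Proof.
move=> mG; have [F FT Foo] := sigma_finiteT mu.
pose Gs s := \big[setI/setT]_(j <- s) G j.
have mGj j : measurable (G j).
  by rewrite mG; apply: sub_gen_smallest; exists j.
have mGs s : measurable (Gs s).
  by rewrite /Gs; elim/big_ind: _ => //; exact: measurableI.
have mGsE : @measurable _ T = <<s range Gs >>.
  apply/seteqP; split.
    rewrite mG; apply: smallest_sub; first exact: smallest_sigma_algebra.
    by move=> _ [j _ <-]; apply: sub_gen_smallest; exists [:: j];
      rewrite // /Gs big_seq1.
  apply: smallest_sub; first exact: sigma_algebra_measurable.
  by move=> _ [s _ <-].
have GsI : setI_closed (range Gs).
  move=> _ _ [s _ <-] [t _ <-]; exists (s ++ t) => //.
  by rewrite /Gs big_cat.
have /choice[w wP] (ns : nat * seq nat) : exists v : L2 mu,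
    forall f : sqint_fun mu, inner (toL2 f) v =
    (\int[mu]_(x in Gs ns.2 `&` F ns.1) complex.Re (f x))%R +i*
    (\int[mu]_(x in Gs ns.2 `&` F ns.1) complex.Im (f x))%R.
  have [mF Foo'] := Foo ns.1; apply: inner_indic; first exact: measurableI.
  apply: le_lt_trans Foo'; apply: le_measure; rewrite ?inE//.
  exact: measurableI.
(* Indices that encode no pair receive the zero vector, which imposes no condition. *)
exists (fun k => if unpickle k is Some ns then w ns else 0) => u u0.
rewrite -(toL2_repr u); set f : sqint_fun mu := repr u.
have f0 n s : inner (toL2 f) (w (n, s)) = 0.
  by have := u0 (pickle (n, s)); rewrite pickleK -(toL2_repr u).
have IF n : mu.-integrable (F n) (fun x => (complex.Re (f x))%:E) /\
    mu.-integrable (F n) (fun x => (complex.Im (f x))%:E).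
  by have [mF Foo'] := Foo n; exact: sqint_integrable_fin.
have ae0 n : {ae mu, forall x, F n x -> f x = 0}.
  have [mF Foo'] := Foo n; have [IR II] := IF n.
  have R0 s : (\int[mu]_(x in Gs s `&` F n) (complex.Re (f x))%:E = 0)%E.
    have := f0 n s; rewrite wP => -[+ _]; rewrite /Rintegral => r0.
    rewrite -[LHS]fineK ?r0//; apply: integrable_fin_num.
      exact: measurableI.
    by apply: (integrableS mF _ _ IR); [exact: measurableI|exact: subIsetr].
  have I0 s : (\int[mu]_(x in Gs s `&` F n) (complex.Im (f x))%:E = 0)%E.
    have := f0 n s; rewrite wP => -[_]; rewrite /Rintegral => r0.
    rewrite -[LHS]fineK ?r0//; apply: integrable_fin_num.
      exact: measurableI.
    by apply: (integrableS mF _ _ II); [exact: measurableI|exact: subIsetr].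
  have aeR : ae_eq mu (F n) (fun x => (complex.Re (f x))%:E) (cst 0%E).
    apply: integral_pi_system_eq0 mGsE GsI mF IR _ _.
      (* The empty intersection is the whole space, so this is the integral over [F n]. *)
      by have := R0 [::]; rewrite /Gs big_nil setTI.
    by move=> _ [s _ <-].
  have aeI : ae_eq mu (F n) (fun x => (complex.Im (f x))%:E) (cst 0%E).
    apply: integral_pi_system_eq0 mGsE GsI mF II _ _.
      by have := I0 [::]; rewrite /Gs big_nil setTI.
    by move=> _ [s _ <-].
  apply: filterS2 aeR aeI => x rx ix Fx.
  by move: (rx Fx) (ix Fx) => [+] [+]; case: (f x) => a b /= -> ->.
rewrite (_ : 0 = toL2 0); last first.
  by rewrite -(scale0r (0 : sqint_fun mu)) toL2Z scale0r.
apply: toL2P; have : {ae mu, forall x, forall n, F n x -> f x = 0}.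
  apply: negligibleS (negligible_bigcup ae0) => x /= /existsNP[n nx].
  by exists n.
apply: filterS => x h; have : [set: T] x by [].
by rewrite FT => -[n _ /h].
Qed.

End L2_separable.

(** * Time-frequency shifts *)

(** The generators are the half-spaces on which one coordinate exceeds a rational. *)
Lemma tuple_countably_generated (R : realType) (n : nat) :
  exists G : nat -> set (n.-tuple R), @measurable _ (n.-tuple R) = <<s range G >>.
Proof.
pose G k : set (n.-tuple R) := if unpickle k is Some iq
  then (fun t : n.-tuple R => tnth t (iq : 'I_n * rat).1) @^-1` `]ratr iq.2, +oo[%classic
  else setT.
exists G; apply/seteqP; split; last first.
  apply: smallest_sub; first exact: sigma_algebra_measurable.
  move=> _ [k _ <-]; rewrite /G; case: unpickle => [[i q]|//].
  by rewrite -[X in measurable X]setTI; apply: measurable_tnth => //;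
    exact: measurable_itv.
have mtnth i : @measurable_fun _ _ (g_sigma_algebraType (range G)) (measurableTypeR R)
    setT (fun t => tnth t i).
  apply: (measurability _ (RGenOInfty.measurableE R)) => _ [_ [x ->] <-].
  (* A half-space with real threshold [x] is the union of those with rational threshold [q > x]. *)
  rewrite setTI (_ : _ @^-1` _ = \bigcup_(q : rat)
      (if x < ratr q then G (pickle (i, q)) else set0)).
    apply: bigcupT_measurable_rat => q; case: ifP => _ //.
    by apply: sub_sigma_algebra; exists (pickle (i, q)).
  apply/seteqP; split=> [t /=|t [q _]].
    rewrite in_itv/= andbT => /rat_in_itvoo[q]; rewrite in_itv/= => /andP[xq qt].
    by exists q => //; rewrite xq /G pickleK/= in_itv/= qt.
  case: ifPn => // xq; rewrite /G pickleK/= !in_itv/= !andbT; exact: lt_trans.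
apply: smallest_sub; first exact: smallest_sigma_algebra.
move=> A; rewrite -bigcup_seq => -[i _ [B mB <-]].
exact: (mtnth i measurableT B mB).
Qed.

(** * Measurability of complex-valued functions and of parametrized inner products *)

Section cmeasurable_theory.
Context {d} {T : measurableType d} {R : realType}.
Implicit Types f g : T -> R[i].

Lemma cmeasurable_cst (c : R[i]) : cmeasurable (fun=> c : R[i]) (T := T).
Proof. by split; exact: measurable_cst. Qed.

Lemma cmeasurableD f g : cmeasurable f -> cmeasurable g ->
  cmeasurable (fun x => f x + g x).
Proof.
move=> [mRf mIf] [mRg mIg]; split.
  by under eq_fun do rewrite ReD; exact: measurable_funD.
by under eq_fun do rewrite ImD; exact: measurable_funD.
Qed.

Lemma cmeasurable_conj f : cmeasurable f -> cmeasurable (fun x => (f x)^*%C).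
Proof.
move=> mf; have := cmeasurable_mul_conj (cmeasurable_cst 1) mf.
by under eq_fun do rewrite mul1r.
Qed.

Lemma cmeasurableM f g : cmeasurable f -> cmeasurable g ->
  cmeasurable (fun x => f x * g x).
Proof.
move=> mf /cmeasurable_conj mg; have := cmeasurable_mul_conj mf mg.
by under eq_fun do rewrite conjcK.
Qed.

Lemma cmeasurable_sum (f : nat -> T -> R[i]) N : (forall k, cmeasurable (f k)) ->
  cmeasurable (fun x => \sum_(0 <= k < N) f k x).
Proof.
move=> mf; elim: N => [|N IH].
  under eq_fun do rewrite big_geq//; exact: cmeasurable_cst.
under eq_fun do rewrite big_nat_recr//=; exact: cmeasurableD.
Qed.

Lemma cmeasurable_cvg (f : nat -> T -> R[i]) g : (forall k, cmeasurable (f k)) ->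
  (forall x, (fun k => normc (f k x - g x)) @ \oo --> (0 : R)) -> cmeasurable g.
Proof.
move=> mf fg; split.
  apply: (@measurable_fun_cvg _ _ _ setT (fun k x => complex.Re (f k x))).
    by move=> k; exact: (mf k).1.
  move=> x _; apply/cvgrPdist_le => e e0; have [N NP] := cvg0_ex (fg x) e0.
  exists N => // n /NP; apply: le_trans; apply: le_trans (normc_Re _).
  by rewrite distrC ReD ReN.
apply: (@measurable_fun_cvg _ _ _ setT (fun k x => complex.Im (f k x))).
  by move=> k; exact: (mf k).2.
move=> x _; apply/cvgrPdist_le => e e0; have [N NP] := cvg0_ex (fg x) e0.
exists N => // n /NP; apply: le_trans; apply: le_trans (normc_Im _).
by rewrite distrC ImD; case: (g x).
Qed.

Lemma cmeasurable_normc f : cmeasurable f -> measurable_fun setT (fun x => normc (f x)).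
Proof.
move=> [mR mI]; rewrite (_ : (fun x => _) = (fun x => Num.sqrt
    (complex.Re (f x) ^+ 2 + complex.Im (f x) ^+ 2))); last first.
  by apply/funext => x; case: (f x).
apply: measurableT_comp; last by apply: measurable_funD; exact: measurable_funX.
by apply: continuous_measurable_fun; exact: sqrt_continuous.
Qed.

End cmeasurable_theory.

Lemma cmeasurable_comp {d1 d2} {T1 : measurableType d1} {T2 : measurableType d2}
    {R : realType} (f : T2 -> R[i]) (g : T1 -> T2) :
  cmeasurable f -> measurable_fun setT g -> cmeasurable (f \o g).
Proof.
by move=> [mR mI] mg; split; [exact: (measurableT_comp mR)|exact: (measurableT_comp mI)].
Qed.

(** Tonelli applied to the positive and negative parts separately; where the integral is infinite,
    [fine] returns 0. *)
Lemma measurable_Rintegral_snd {d1 d2} {T1 : measurableType d1}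
    {T2 : measurableType d2} {R : realType}
    (m : {sigma_finite_measure set T2 -> \bar R}) (K : T1 * T2 -> R) :
  measurable_fun setT K ->
  measurable_fun setT (fun x => \int[m]_y K (x, y)).
Proof.
move=> mK; rewrite /Rintegral.
apply: (measurableT_comp (@fine_measurable R _ measurableT)).
under eq_fun do rewrite integralE.
have mK' : measurable_fun setT (EFin \o K) by exact/measurable_EFinP.
apply: emeasurable_funB.
  rewrite (_ : (fun x => _) = fubini_F m ((EFin \o K)^\+)%E).
    exact: measurable_fun_fubini_tonelli_F _ (measurable_funepos mK') (funepos_ge0 _).
  by apply/funext => x; apply: eq_integral => y _; rewrite !funeposE.
rewrite (_ : (fun x => _) = fubini_F m ((EFin \o K)^\-)%E).
  exact: measurable_fun_fubini_tonelli_F _ (measurable_funeneg mK') (funeneg_ge0 _).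
by apply/funext => x; apply: eq_integral => y _; rewrite !funenegE.
Qed.

(** Parseval: the inner product is the pointwise limit of the sums of [<a x, e k>] times the
    conjugate of [<b x, e k>]. *)
Lemma cmeasurable_inner {d0} {X : measurableType d0} {d} {T : measurableType d}
    {R : realType} (mu : {measure set T -> \bar R}) (e : nat -> L2 mu)
    (a b : X -> L2 mu) :
  orthonormal0 (@inner d T R mu) e -> ip_total (@inner d T R mu) e ->
  (forall h, cmeasurable (fun x => inner (a x) h)) ->
  (forall h, cmeasurable (fun x => inner (b x) h)) ->
  cmeasurable (fun x => inner (a x) (b x)).
Proof.
move=> e_on e_total ma mb; have ax := inner_L2 mu.
apply: (@cmeasurable_cvg _ _ _ (fun N x => \sum_(0 <= k < N)
    inner (a x) (e k) * (inner (b x) (e k))^*%C)).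
  by move=> N; apply: cmeasurable_sum => k; exact: cmeasurable_mul_conj.
move=> x; apply: (@cvg0_le _ _ (fun N => ip_norm (@inner d T R mu) (a x) *
    ip_norm (@inner d T R mu) (expansion (@inner d T R mu) e N (b x) - b x))).
  move=> N; rewrite normc_ge0/=.
  apply: le_trans (ip_CauchySchwarz ax _ _); rewrite (ipBr ax) (ip_sumr ax).
  rewrite le_eqVlt; apply/orP; left; apply/eqP; congr (normc (_ - _)).
  by apply: eq_bigr => k _; rewrite (ipZr ax) mulrC.
rewrite -(mulr0 (ip_norm (@inner d T R mu) (a x))).
exact: cvgMl_tmp (cvg_expansion ax e_on (L2_complete (mu := mu)) e_total (b x)).
Qed.

(** * Basis, adjoints and time-frequency shifts on L2 of Euclidean space *)

Section L2_leb.
Context {R : realType} {d : nat}.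
Local Notation Rd := (d.-tuple R).
Local Notation H := (L2 (@leb R d)).
Local Notation ip := (@inner _ _ R (@leb R d)).
Local Notation nm := (ip_norm ip).

Lemma L2_leb_basis : exists e : nat -> H, orthonormal0 ip e /\ ip_total ip e.
Proof.
have [G mG] := tuple_countably_generated R d.
have [v v_total] := L2_separable (leb d) mG.
exists (gs_vec ip v); split; first exact: gs_orthonormal0 (inner_L2 _) _.
exact: gs_total (inner_L2 _) _ v_total.
Qed.

Lemma adjointE (A : H -> H) (C : R) : linear A -> 0 <= C ->
  (forall u, nm (A u) <= C * nm u) ->
  forall f g, inner (A f) g = inner f (adjoint A g).
Proof.
move=> lA C0 bA f g; have [e [e_on e_total]] := L2_leb_basis.
have [h hP] := adjoint_exists (inner_L2 _) g (@L2_complete _ _ _ _) e_on e_total lA C0 bA.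
(* Existence of [h] rules out the default branch in the choice that defines [adjoint]. *)
by move: f; apply: (@xgetPex _ 0 [set h | forall f, inner (A f) g = inner f h]); exists h.
Qed.

Lemma inner_extr (u v : H) : (forall f, inner f u = inner f v) -> u = v.
Proof.
move=> uv; have ax := inner_L2 (@leb R d); apply/eqP; rewrite -subr_eq0; apply/eqP.
by apply: (ip_eq0 ax); rewrite (ipBr ax) uv subrr.
Qed.

Lemma adjoint_linear (A : H -> H) (C : R) : linear A -> 0 <= C ->
  (forall u, nm (A u) <= C * nm u) -> linear (adjoint A).
Proof.
move=> lA C0 bA a u v; have ax := inner_L2 (@leb R d).
have adjE := adjointE lA C0 bA.
by apply: inner_extr => f; rewrite -adjE !(ipDr ax, ipZr ax) -!adjE.
Qed.

(** With [v = adjoint A u], one has [|v|^2 = <A v, u> <= C |v| |u|]; cancel [|v|]. *)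
Lemma adjoint_bound (A : H -> H) (C : R) : linear A -> 0 <= C ->
  (forall u, nm (A u) <= C * nm u) -> forall u, nm (adjoint A u) <= C * nm u.
Proof.
move=> lA C0 bA u; have ax := inner_L2 (@leb R d).
have adjE := adjointE lA C0 bA.
have [->|n0] := eqVneq (nm (adjoint A u)) 0; first by rewrite mulr_ge0 ?ip_norm_ge0.
have npos : 0 < nm (adjoint A u) by rewrite lt0r n0 ip_norm_ge0.
rewrite -(ler_pM2l npos) -expr2 (sqr_ip_norm ax) -adjE mulrCA.
rewrite (le_trans (ler_norm _))// (le_trans (normc_Re _))//.
rewrite (le_trans (ip_CauchySchwarz ax _ _))// mulrA.
by rewrite ler_wpM2r ?ip_norm_ge0.
Qed.

Lemma tfshift_linear (z : Rd * Rd) : linear (@tfshift R d z).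
Proof.
move=> a u v; rewrite -(toL2_repr u) -(toL2_repr v) -toL2Z -toL2D.
rewrite /toL2 !tfshift_pi -!/(toL2 _) -toL2Z -toL2D; apply: toL2P; apply: aeW => y.
by rewrite /= /tfshift_fun !fctE /= mulrDr mulrCA.
Qed.

(** The phase factor has modulus 1 and Lebesgue measure is translation invariant. *)
Lemma tfshift_norm (z : Rd * Rd) (u : H) : nm (tfshift z u) = nm u.
Proof.
have ax := inner_L2 (@leb R d).
apply/eqP; rewrite -(@eqrXn2 _ 2) ?ip_norm_ge0//; apply/eqP.
rewrite -(toL2_repr u) /toL2 tfshift_pi -!/(toL2 _); apply: EFin_inj.
rewrite !sqr_L2norm /= /tfshift_fun.
rewrite -[RHS](@ge0_integral_tsub R d z.1); last 2 first.
- exact: measurable_sqr_normc (sqint_cmeasurable _).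
- by move=> y; rewrite lee_fin sqr_ge0.
by apply: eq_integral => y _; rewrite normcM normc_expi mul1r.
Qed.

(** Joint measurability in the shift [z] and the point [y] is what allows [y] to be integrated out
    in [cmeasurable_inner_tfshift]. *)
Lemma cmeasurable_tfshift_fun (f : Rd -> R[i]) : cmeasurable f ->
  cmeasurable (fun zy : (Rd * Rd) * Rd => tfshift_fun zy.1 f zy.2).
Proof.
move=> mf.
have mz1 i : measurable_fun setT (fun zy : (Rd * Rd) * Rd => tnth zy.1.1 i).
  by apply: (measurableT_comp (measurable_tnth i)); exact: measurableT_comp.
have mz2 i : measurable_fun setT (fun zy : (Rd * Rd) * Rd => tnth zy.1.2 i).
  by apply: (measurableT_comp (measurable_tnth i)); exact: measurableT_comp.
have my i : measurable_fun setT (fun zy : (Rd * Rd) * Rd => tnth zy.2 i).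
  exact: (measurableT_comp (measurable_tnth i)).
apply: cmeasurableM.
  have mt : measurable_fun setT (fun zy : (Rd * Rd) * Rd => 2 * pi * tdot zy.1.2 zy.2).
    by apply: measurable_funM => //; apply: measurable_sum => i; exact: measurable_funM.
  split.
    apply: (measurableT_comp _ mt); apply: continuous_measurable_fun.
    exact: continuous_cos.
  apply: (measurableT_comp _ mt); apply: continuous_measurable_fun.
  exact: continuous_sin.
apply: (cmeasurable_comp mf (g := fun zy : (Rd * Rd) * Rd => tsub zy.2 zy.1.1)).
apply/measurable_fun_tnthP => i; rewrite /comp.
by under eq_fun do rewrite tnth_mktuple; exact: measurable_funB.
Qed.

Lemma cmeasurable_inner_tfshift (u v : H) :
  cmeasurable (fun z : Rd * Rd => inner (tfshift z u) v).
Proof.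
rewrite -(toL2_repr u) -(toL2_repr v); set f := repr u; set g := repr v.
under eq_fun do rewrite /toL2 tfshift_pi -!/(toL2 _) inner_toL2 /=.
have [mR mI] := cmeasurable_mul_conj (cmeasurable_tfshift_fun (sqint_cmeasurable f))
  (cmeasurable_comp (sqint_cmeasurable g) (@measurable_snd _ _ (Rd * Rd)%type Rd)).
split => /=.
  exact: (measurable_Rintegral_snd (leb d) mR).
exact: (measurable_Rintegral_snd (leb d) mI).
Qed.

End L2_leb.

(** * The norm of L^p(Omega) *)

Lemma powR_cvg0 {R : realType} (a : nat -> R) (r : R) : 0 < r ->
  (forall n, 0 <= a n) -> a @ \oo --> (0 : R) ->
  (fun n => a n `^ r) @ \oo --> (0 : R).
Proof.
move=> r0 a0 acvg; apply: cvg0P => [n|e e0]; first exact: powR_ge0.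
have [N NP] := cvg0_ex acvg (powR_gt0 r^-1 e0); exists N => n /NP le.
rewrite -[leRHS](powRr1 (ltW e0)) -(mulVf (lt0r_neq0 r0)) powRrM.
by rewrite ge0_ler_powR ?nnegrE ?powR_ge0 ?(ltW r0).
Qed.

Section Lp_on_set.
Context {d} {T : measurableType d} {R : realType}.
Variables (m : {measure set T -> \bar R}) (Omega : set T) (p : R).
Hypotheses (mOmega : measurable Omega) (Omega_lty : (m Omega < +oo)%E).
Hypothesis p1 : 1 <= p.
Implicit Types G : T -> R.

Let p0 : 0 < p. Proof. exact: lt_le_trans p1. Qed.
Let p_neq0 : p != 0. Proof. exact: lt0r_neq0. Qed.

Definition LpO G : \bar R := 'N[m]_(p%:E)[EFin \o (G \_ Omega)].

Let I G : \bar R := (\int[m]_(x in Omega) (`|G x| `^ p)%:E)%E.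

Let I_ge0 G : (0 <= I G)%E.
Proof. by apply: integral_ge0 => x _; rewrite lee_fin powR_ge0. Qed.

Let LpOE G : LpO G = (I G `^ p^-1)%E.
Proof.
rewrite /LpO unlock /I [in RHS]integral_mkcond; congr (_ `^ _)%E; apply: eq_integral => x _.
rewrite /= !patchE; case: (x \in Omega) => //=.
by rewrite normr0 powR0.
Qed.

Let measurable_powR G : measurable_fun setT G ->
  measurable_fun Omega (fun x => (`|G x| `^ p)%:E).
Proof.
move=> mG; apply: measurable_funTS; apply/measurable_EFinP.
exact: (measurableT_comp (measurable_powR p) (measurableT_comp (@normr_measurable _ _) mG)).
Qed.

Lemma LpO_ge0 G : (0 <= LpO G)%E.
Proof. exact: Lnorm_ge0. Qed.

Lemma le_LpO G1 G2 : measurable_fun setT G1 -> measurable_fun setT G2 ->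
  (forall x, `|G1 x| <= `|G2 x|) -> (LpO G1 <= LpO G2)%E.
Proof.
move=> m1 m2 le; rewrite !LpOE; apply: gt0_ler_poweR.
- by rewrite invr_ge0 ltW.
- by rewrite in_itv/= I_ge0 leey.
- by rewrite in_itv/= I_ge0 leey.
- apply: ge0_le_integral => //; try exact: measurable_powR.
  by move=> x _; rewrite lee_fin ge0_ler_powR ?nnegrE ?(ltW p0).
Qed.

Lemma LpO_bound G c : measurable_fun setT G -> 0 <= c ->
  (forall x, `|G x| <= c) -> (LpO G <= (c * fine (m Omega) `^ p^-1)%:E)%E.
Proof.
move=> mG c0 Gc.
have IE : (I (cst c) = (c `^ p * fine (m Omega))%:E)%E.
  rewrite /I /= integral_cst// EFinM fineK ?ger0_norm//.
  by rewrite ge0_fin_numE.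
have Gc' x : `|G x| <= `|cst c x| by rewrite [leRHS]ger0_norm.
apply: le_trans (le_LpO mG (@measurable_cst _ _ _ _ setT c) Gc') _.
rewrite LpOE IE poweR_EFin lee_fin powRM ?powR_ge0// ?fine_ge0//.
by rewrite -powRrM mulfV// powRr1.
Qed.

Lemma LpO_fin_num G c : measurable_fun setT G -> (forall x, `|G x| <= c) ->
  LpO G \is a fin_num.
Proof.
move=> mG Gc; rewrite ge0_fin_numE ?LpO_ge0//.
have c0 : 0 <= `|c| by [].
apply: le_lt_trans (LpO_bound mG c0 _) (ltry _) => x.
exact: le_trans (Gc x) (ler_norm _).
Qed.

Lemma LpO_scale G c : measurable_fun setT G -> 0 <= c ->
  LpO (fun x => c * G x) = (c%:E * LpO G)%E.
Proof.
move=> mG c0; rewrite !LpOE (_ : I _ = (c `^ p)%:E * I G)%E; last first.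
  rewrite /I -ge0_integralZl_EFin ?powR_ge0//; last exact: measurable_powR.
  apply: eq_integral => x _.
  by rewrite normrM powRM// EFinM ger0_norm.
rewrite poweRM ?lee_fin ?powR_ge0// poweR_EFin -powRrM mulfV// powRr1//.
Qed.

Lemma LpO_add G1 G2 : measurable_fun setT G1 -> measurable_fun setT G2 ->
  (LpO (fun x => G1 x + G2 x)%R <= LpO G1 + LpO G2)%E.
Proof.
move=> m1 m2; rewrite /LpO.
have mr G : measurable_fun setT G -> measurable_fun setT (G \_ Omega).
  move=> mG; apply/(measurable_restrictT _ mOmega); exact: measurable_funTS.
rewrite (_ : _ \_ Omega = ((G1 \_ Omega) \+ (G2 \_ Omega))%R).
  exact: minkowski_EFin (mr _ m1) (mr _ m2) p1.
apply/funext => x /=; rewrite !patchE.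
by case: ifP => // _; rewrite addr0.
Qed.

(** Dominated convergence for the p-th powers; the constant dominating function is integrable
    because [Omega] has finite measure. *)
Lemma LpO_cvg0 (G : nat -> T -> R) K : (forall n, measurable_fun setT (G n)) ->
  (forall n x, `|G n x| <= K) ->
  (forall x, (fun n => `|G n x|) @ \oo --> (0 : R)) ->
  (fun n => fine (LpO (G n))) @ \oo --> (0 : R).
Proof.
move=> mG GK Gcvg.
have : (fun n => I (G n)) @ \oo --> (\int[m]_(x in Omega) 0)%E.
  apply: (@dominated_cvg _ _ _ m Omega mOmega _ _ (fun=> (`|K| `^ p)%:E)) => //.
  - by move=> n; exact: measurable_powR.
  - move=> x _; apply: cvg_EFin; first exact: nearW.
    by apply: powR_cvg0 => // n; exact: normr_ge0.
  - apply/integrableP; split; first exact: measurable_cst.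
    by rewrite /= integral_cst// lte_mul_pinfty ?lee_fin.
  - move=> n x _; rewrite gee0_abs ?lee_fin ?powR_ge0// ge0_ler_powR ?nnegrE ?(ltW p0)//.
    exact: le_trans (GK n x) (ler_norm _).
rewrite integral0 => /fine_cvgP[_ cvgI].
under eq_fun do rewrite LpOE fine_poweR.
apply: powR_cvg0 => //; first by rewrite invr_gt0.
by move=> n; exact: fine_ge0.
Qed.

End Lp_on_set.

(** * The sesquilinear form behind the quadratic representation *)

Section quadratic_representation.
Context {R : realType} {d : nat}.
Local Notation Rd := (d.-tuple R).
Local Notation H := (L2 (@leb R d)).
Local Notation ip := (@inner _ _ R (@leb R d)).
Local Notation nm := (ip_norm ip).
Variables (S : {linear H -> H}) (C : R).
Hypotheses (C0 : 0 <= C) (bS : forall u, nm (S u) <= C * nm u).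

Let ax := inner_L2 (@leb R d).

Let tf_bound (z : Rd * Rd) u : nm (tfshift z u) <= 1 * nm u.
Proof. by rewrite tfshift_norm mul1r. Qed.

Local Notation unshift z := (adjoint (@tfshift R d z)).

Let S_linear : linear S. Proof. exact: linearP. Qed.

Let unshiftE z u v : inner (tfshift z u) v = inner u (unshift z v).
Proof. exact: (adjointE (tfshift_linear z) ler01 (tf_bound z)). Qed.

Let unshift_linear z : linear (unshift z).
Proof. exact: (adjoint_linear (tfshift_linear z) ler01 (tf_bound z)). Qed.

Let unshift_bound z u : nm (unshift z u) <= nm u.
Proof.
have := adjoint_bound (tfshift_linear z) ler01 (tf_bound z) u.
by rewrite mul1r.
Qed.

Let inner_unshift z u v : inner (unshift z u) v = (inner (tfshift z v) u)^*%C.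
Proof. by rewrite unshiftE (ipJ ax). Qed.

Definition sesq_rep (f g : H) (z : Rd * Rd) : R[i] :=
  inner (S (adjoint (tfshift z) f)) (adjoint (tfshift z) g).

Lemma quad_repE f z : quad_rep S f z = sesq_rep f f z.
Proof. by rewrite /quad_rep /opshift /= unshiftE. Qed.

(** Moving [S] to the other side by its adjoint, the coefficients of both arguments become
    conjugates of functions [z |-> <tfshift z u, v>]. *)
Lemma cmeasurable_sesq_rep f g : cmeasurable (sesq_rep f g).
Proof.
have [e [e_on e_total]] := @L2_leb_basis R d.
apply: (cmeasurable_inner e_on e_total) => h; last first.
  under eq_fun do rewrite inner_unshift; apply: cmeasurable_conj.
  exact: cmeasurable_inner_tfshift.
under eq_fun do rewrite (adjointE S_linear C0 bS) inner_unshift.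
by apply: cmeasurable_conj; exact: cmeasurable_inner_tfshift.
Qed.

Lemma sesq_rep_bound f g z : normc (sesq_rep f g z) <= C * nm f * nm g.
Proof.
apply: le_trans (ip_CauchySchwarz ax _ _) _.
apply: ler_pM; [exact: ip_norm_ge0|exact: ip_norm_ge0| |exact: unshift_bound].
apply: le_trans (bS _) _; rewrite ler_wpM2l//; exact: unshift_bound.
Qed.

Lemma sesq_repD f g z : sesq_rep (f + g) (f + g) z =
  sesq_rep f f z + sesq_rep g g z + (sesq_rep f g z + sesq_rep g f z).
Proof.
have uD : unshift z (f + g) = unshift z f + unshift z g.
  by have := unshift_linear z 1 f g; rewrite !scale1r.
have SD u v : S (u + v) = S u + S v by exact: raddfD.
by rewrite /sesq_rep uD SD (ip_addadd ax).
Qed.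

Lemma sesq_repZ (a : R) f z : sesq_rep (a%:C *: f) (a%:C *: f) z =
  (a ^+ 2)%:C * sesq_rep f f z.
Proof.
have u0 : unshift z 0 = 0.
  by have := unshift_linear z (-1) 0 0; rewrite !scaler0 !scaleN1r addr0 addNr.
have uZ : unshift z (a%:C *: f) = a%:C *: unshift z f.
  by have := unshift_linear z a%:C f 0; rewrite u0 !addr0.
have SZ u : S (a%:C *: u) = a%:C *: S u by exact: linearZ.
by rewrite /sesq_rep uZ SZ (ip_scale_scale ax).
Qed.

(** For fixed [z], each cross term is, up to conjugation, the pairing of [u n] with a vector
    independent of [n]. *)
Lemma sesq_rep_cvg0 (u : nat -> H) f z :
  (forall g, (fun n => normc (inner (u n) g)) @ \oo --> (0 : R)) ->
  (fun n => normc (sesq_rep f (u n) z + sesq_rep (u n) f z)) @ \oo --> (0 : R).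
Proof.
move=> u0.
apply: (@cvg0_le _ _ (fun n =>
   normc (inner (u n) (tfshift z (S (unshift z f)))) +
   normc (inner (u n) (tfshift z (adjoint S (unshift z f)))))); last first.
  by rewrite -(addr0 0); apply: cvgD; exact: u0.
have unshiftE' v w : inner (unshift z v) w = inner v (tfshift z w).
  by rewrite inner_unshift (ipJ ax).
move=> n; rewrite normc_ge0 andTb; apply: le_trans (le_normcD _ _) _.
apply: lerD; rewrite /sesq_rep.
  by rewrite -(ipJ ax) normc_conj unshiftE'.
by rewrite (adjointE S_linear C0 bS) unshiftE'.
Qed.

Definition rep_modulus f : @phase_space R d -> R := fun z => normc (quad_rep S f z).

Definition cross_modulus f g : @phase_space R d -> R :=
  fun z => normc (sesq_rep f g z + sesq_rep g f z).

Lemma rep_modulusD f g z : rep_modulus (f + g) z <=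
  rep_modulus f z + rep_modulus g z + cross_modulus f g z.
Proof.
rewrite /rep_modulus !quad_repE sesq_repD.
exact: (le_normcD3 (sesq_rep f f z) (sesq_rep g g z)).
Qed.

(** Sets of the product sigma-algebra are Caratheodory measurable, so completion keeps [F]
    measurable. *)
Lemma measurable_phase_space (F : Rd * Rd -> R) :
  measurable_fun setT F -> measurable_fun setT (F : @phase_space R d -> R).
Proof.
move=> mF _ Y mY; rewrite setTI.
apply: sub_caratheodory; apply: sub_sigma_algebra.
by have := mF measurableT Y mY; rewrite setTI.
Qed.

Lemma measurable_rep_modulus f : measurable_fun setT (rep_modulus f).
Proof.
apply: measurable_phase_space; apply: cmeasurable_normc.
rewrite (_ : quad_rep S f = sesq_rep f f); first exact: cmeasurable_sesq_rep.
by apply/funext => z; exact: quad_repE.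
Qed.

Lemma measurable_cross_modulus f g : measurable_fun setT (cross_modulus f g).
Proof.
apply: measurable_phase_space; apply: cmeasurable_normc.
by apply: cmeasurableD; exact: cmeasurable_sesq_rep.
Qed.

Lemma quad_rep_normE p Omega f :
  quad_rep_norm p Omega S f = LpO phase_measure Omega p (rep_modulus f).
Proof. by rewrite /quad_rep_norm /LpO -restrict_EFin. Qed.

End quadratic_representation.

(** * Maximizing sequences *)

(** The upper limit is the limit of the tail suprema, so one of these is already below [L]; it is
    finite and serves as [r]. *)
Lemma limn_esup_lt_bound {R : realType} (v : nat -> R) (L : R) :
  (limn_esup (fun n => (v n)%:E) < L%:E)%E ->
  exists2 r, r < L & exists N, forall n, (N <= n)%N -> v n <= r.
Proof.
set u := fun n => (v n)%:E; rewrite limn_esup_lim => limL.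
have [N uN] : exists N, (esups u N < L%:E)%E.
  apply: contrapT => /forallNP noN; move: limL; apply/negP; rewrite -leNgt.
  apply: lime_ge; first exact: is_cvg_esups.
  by apply: nearW => n; rewrite leNgt; apply/negP; exact: noN.
have le n : (N <= n)%N -> ((v n)%:E <= esups u N)%E.
  by move=> Nn; apply: ereal_sup_ubound; exists n.
have fin : esups u N \is a fin_num.
  rewrite fin_numElt (lt_le_trans _ (le N (leqnn N))) ?ltNyr//=.
  by rewrite (lt_trans uN) ?ltry.
exists (fine (esups u N)); first by rewrite -lte_fin fineK.
by exists N => n /le; rewrite -lee_fin fineK.
Qed.

Lemma weak_cvg0 {d} {T : measurableType d} {R : realType}
    (mu : {measure set T -> \bar R}) (u : nat -> L2 mu) :
  (forall g, (fun n => normc (inner (u n) g)) @ \oo --> (0 : R)) -> weak_cvg u 0.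
Proof.
move=> u0 g; rewrite (ip0l (inner_L2 mu)).
(* The radius [e] is a positive element of [R[i]], hence has zero imaginary part and positive real
   part. *)
apply/(@cvgrPdist_le R[i] R[i]^o) => e; rewrite ltcE /= => /andP[/eqP ime ree].
have [N NP] := cvg0_ex (u0 g) ree; exists N => // n /NP le.
rewrite sub0r normrN; move: (inner (u n) g) le => z.
by rewrite normc_def lecE /= ime eqxx/=; case: z.
Qed.

(** * Attainment of the supremum *)

Section attainment.
Context {R : realType} {d : nat}.
Local Notation H := (L2 (@leb R d)).
Local Notation ip := (@inner _ _ R (@leb R d)).
Local Notation nm := (ip_norm ip).
Variables (S : {linear H -> H}) (C : R) (p : R) (Omega : set (@phase_space R d)).
Hypotheses (C0 : 0 <= C) (bS : forall u, nm (S u) <= C * nm u) (p1 : 1 <= p).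
Hypotheses (mOmega : measurable Omega) (Omega_lty : (phase_measure Omega < +oo)%E).

Let ax := inner_L2 (@leb R d).
(** Upper bound for the concentration ratio: the modulus of [quad_rep S f] is at most [C |f|^2]
    pointwise, and the constant 1 has norm [|Omega|^(1/p)]. *)
Let K := C * fine (phase_measure Omega) `^ p^-1.

Let w f := fine (quad_rep_norm p Omega S f).
Let x f g := fine (LpO phase_measure Omega p (cross_modulus S f g)).

Let mrep f := measurable_rep_modulus C0 bS f.
Let mcross f g := measurable_cross_modulus C0 bS f g.

Let rep_bound f z : `|rep_modulus S f z| <= C * nm f ^+ 2.
Proof.
rewrite ger0_norm ?normc_ge0// /rep_modulus quad_repE expr2 mulrA.
exact: sesq_rep_bound.
Qed.

Let cross_bound f g z : `|cross_modulus S f g z| <= C * nm f * nm g *+ 2.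
Proof.
rewrite ger0_norm ?normc_ge0// mulr2n; apply: le_trans (le_normcD _ _) _.
apply: lerD; first exact: sesq_rep_bound.
by rewrite mulrAC; exact: sesq_rep_bound.
Qed.

Let wE f : quad_rep_norm p Omega S f = (w f)%:E.
Proof.
rewrite /w fineK// quad_rep_normE.
exact: (LpO_fin_num mOmega Omega_lty p1 (mrep f) (rep_bound f)).
Qed.

Let xE f g : LpO phase_measure Omega p (cross_modulus S f g) = (x f g)%:E.
Proof.
rewrite /x fineK//.
exact: (LpO_fin_num mOmega Omega_lty p1 (mcross f g) (cross_bound f g)).
Qed.

Let w_le f : w f <= K * nm f ^+ 2.
Proof.
rewrite -lee_fin -wE quad_rep_normE /K mulrAC.
apply: (LpO_bound mOmega Omega_lty p1 (mrep f) _ (rep_bound f)).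
by rewrite mulr_ge0 ?sqr_ge0.
Qed.

Let wZ a f : w (a%:C *: f) = a ^+ 2 * w f.
Proof.
apply: EFin_inj; rewrite EFinM -!wE !quad_rep_normE.
rewrite -(LpO_scale _ mOmega p1 (mrep f)) ?sqr_ge0//.
congr LpO; apply/funext => z; rewrite /rep_modulus !quad_repE sesq_repZ//.
by rewrite normcM normc_real ger0_norm ?sqr_ge0.
Qed.

Let wD f g : w (f + g) <= w f + w g + x f g.
Proof.
rewrite -lee_fin !EFinD -!wE !quad_rep_normE -xE.
apply: le_trans (leeD (LpO_add _ mOmega p1 (mrep f) (mrep g)) (lexx _)).
apply: le_trans (LpO_add _ mOmega p1 (measurable_funD (mrep f) (mrep g)) (mcross f g)).
apply: (le_LpO _ mOmega p1 (mrep _)).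
  by apply: measurable_funD (mcross f g); exact: measurable_funD (mrep f) (mrep g).
move=> z; rewrite !ger0_norm ?addr_ge0 ?normc_ge0//.
exact: rep_modulusD.
Qed.

Let x_cvg0 f (u : nat -> H) M : (forall n, nm (u n) <= M) ->
  (forall g, (fun n => normc (inner (u n) g)) @ \oo --> (0 : R)) ->
  (fun n => x f (u n)) @ \oo --> (0 : R).
Proof.
move=> uM u0; apply: (@LpO_cvg0 _ _ _ phase_measure Omega p mOmega Omega_lty p1
    (fun n => cross_modulus S f (u n)) (C * nm f * M *+ 2)).
- by move=> n; exact: mcross.
- move=> n z; apply: le_trans (cross_bound _ _ _) _; rewrite lerMn2r/=.
  by rewrite ler_wpM2l// mulr_ge0 ?ip_norm_ge0.
- move=> z; rewrite (_ : (fun n => _) =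
      (fun n => normc (sesq_rep S f (u n) z + sesq_rep S (u n) f z))).
    exact: (sesq_rep_cvg0 C0 bS).
  by apply/funext => n; rewrite ger0_norm ?normc_ge0.
Qed.

Lemma concentration_attained :
  (ess_concentration p Omega S < concentration p Omega S)%E ->
  exists f : H, f != 0 /\
    quad_rep_norm p Omega S f =
      (concentration p Omega S * (L2norm f ^+ 2)%:E)%E.
Proof.
move=> gap.
have ratioE f : (quad_rep_norm p Omega S f * ((L2norm f ^+ 2)^-1)%:E)%E
    = (w f / nm f ^+ 2)%:E by rewrite wE.
have nm2_gt0 f : f != 0 -> 0 < nm f ^+ 2.
  by move=> f0; rewrite exprn_gt0// (ip_norm_gt0 ax).
have [L LE] : exists L, concentration p Omega S = L%:E.
  have fin : concentration p Omega S \is a fin_num.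
    rewrite fin_numE; apply/andP; split.
      (* The strict gap excludes the value [-oo]. *)
      by apply: contraTneq gap => ->; rewrite -leNgt leNye.
    rewrite -ltey; apply: (@le_lt_trans _ _ K%:E); last exact: ltry.
    apply: ge_ereal_sup => _ [f /= f0 <-]; rewrite ratioE lee_fin.
    by rewrite ler_pdivrMr ?nm2_gt0.
  by exists (fine (concentration p Omega S)); rewrite fineK.
rewrite LE in gap *.
have wL f : w f <= L * nm f ^+ 2.
  have [->|f0] := eqVneq f 0.
    by have := w_le 0; rewrite (ip_norm0 ax) expr0n !mulr0.
  rewrite -ler_pdivrMr ?nm2_gt0// -lee_fin -ratioE -LE.
  by apply: ereal_sup_ubound; exists f.
have /choice[F FP] n : exists f : H, nm f = 1 /\ L - n.+1%:R^-1 < w f.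
  have : ((L - n.+1%:R^-1)%:E < concentration p Omega S)%E.
    by rewrite LE lte_fin ltrBlDr ltrDl invr_gt0.
  move=> /ereal_sup_gt[_ [f /= f0 <-]]; rewrite ratioE lte_fin => Lf.
  have nf := ip_norm_gt0 ax f0.
  exists (((nm f)^-1)%:C *: f); split.
    rewrite (ip_normZ ax) normc_real ger0_norm ?invr_ge0 ?ip_norm_ge0//.
    by rewrite mulVf ?gt_eqF.
  by rewrite wZ exprVn mulrC.
have [e [e_on e_total]] := @L2_leb_basis R d.
have F1 n : nm (F n) <= 1 by rewrite (FP n).1.
have [phi [h [phin weak]]] := weak_limit ax (@L2_complete _ _ _ _) e_on e_total F1.
pose g n := F (phi n) - h.
have gM n : nm (g n) <= 1 + nm h.
  apply: le_trans (ler_ip_normD ax _ _) _.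
  by rewrite (ip_normN ax) (FP (phi n)).1.
have xcvg := x_cvg0 h gM weak.
set t := nm h ^+ 2.
(* Expand [1 = |h + g n|^2]; the term [2 Re <g n, h>] tends to 0 by weak convergence. *)
have scvg : (fun n => nm (g n) ^+ 2) @ \oo --> 1 - t.
  have -> : (fun n => nm (g n) ^+ 2) = (fun n => 1 - t - 2 * complex.Re (ip (g n) h)).
    apply/funext => n; have := (FP (phi n)).1 => /(congr1 (fun r => r ^+ 2)).
    rewrite -[F _](subrK h) -/(g n) (sqr_ip_normD ax) expr1n -/t.
    have arith (a r : R) : a + t + 2 * r = 1 -> a = 1 - t - 2 * r.
      by move=> E; rewrite -[X in X - t]E addrAC !addrK.
    exact: arith.
  rewrite -[X in _ --> X]subr0; apply: cvgB; first exact: cvg_cst.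
  rewrite -(mulr0 2); apply: cvgMl_tmp; apply/cvgr0Pnorm_le => eps eps0.
  have /cvgr0Pnorm_le/(_ _ eps0) := weak h; apply: filterS => n; apply: le_trans.
  by rewrite [leRHS]ger0_norm ?normc_ge0// normc_Re.
have t1 : t <= 1.
  rewrite -subr_ge0; apply: (cvgr_to_ge scvg); apply: nearW => n.
  exact: sqr_ge0.
(* The error of [F (phi n)] is below [(phi n).+1^-1], hence at most [n.+1^-1] because
   [n <= phi n]. *)
have Lle n : L <= w h + w (g n) + x h (g n) + n.+1%:R^-1.
  rewrite -lerBlDr; apply: le_trans (wD h (g n)); rewrite /g subrKC.
  apply: le_trans (ltW (FP (phi n)).2); rewrite lerD2l lerN2.
  by rewrite lef_pV2 ?posrE// ler_nat ltnS.
(* If [t = 1], then [|g n|] tends to 0, so [w (g n) <= K |g n|^2] disappears in the limit of [Lle]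
   and [L <= w h]. *)
have [tE|t_neq1] := eqVneq t 1.
  have Lw : L <= w h.
    rewrite -subr_le0; apply: (@cvg0_cst_le _ _ (fun n =>
        K * nm (g n) ^+ 2 + x h (g n) + n.+1%:R^-1)).
      move=> n; rewrite lerBlDl; apply: le_trans (Lle n) _.
      by rewrite !addrA !lerD2r lerD2l; exact: w_le.
    have -> : (0 : R) = K * 0 + 0 + 0 by rewrite mulr0 !addr0.
    apply: cvgD; last exact: cvg_harmonic.
    apply: cvgD => //; apply: cvgMl_tmp.
    by move: scvg; rewrite tE subrr.
  exists h; split.
    apply/eqP => h0; have := tE; rewrite /t h0 (ip_norm0 ax) expr0n/= => /eqP.
    by rewrite eq_sym oner_eq0.
  rewrite wE -EFinM -[L2norm h]/(nm h) -/t tE mulr1; congr EFin; apply/eqP.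
  by rewrite eq_le Lw andbT -(mulr1 L) -tE wL.
exfalso.
have t_lt1 : 0 < 1 - t by rewrite subr_gt0 lt_neqAle t_neq1.
have half : 0 < (1 - t) / 2 by rewrite divr_gt0.
(* Half of the limit bounds [|g n|^2] below from [N] on, so normalizing these vectors preserves weak
   convergence to 0. *)
have [N _ NP] : \forall n \near \oo, (1 - t) / 2 <= nm (g n) ^+ 2.
  apply: (cvgr_ge _ scvg).
  by rewrite ltr_pdivrMr// ltr_pMr// ltr1n.
pose gN n := g (n + N)%N.
have gN_gt0 n : 0 < nm (gN n).
  rewrite lt0r ip_norm_ge0 andbT; apply: contraTneq half => n0.
  rewrite -leNgt (le_trans (NP (n + N)%N _))//= ?leq_addl//.
  by rewrite -/(gN n) n0 expr0n.
pose hN n := ((nm (gN n))^-1)%:C *: gN n.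
have hN1 n : nm (hN n) = 1.
  rewrite (ip_normZ ax) normc_real ger0_norm ?invr_ge0 ?ip_norm_ge0//.
  by rewrite mulVf ?gt_eqF.
have hN_weak : weak_cvg hN 0.
  apply: weak_cvg0 => v.
  pose k := Num.sqrt ((1 - t) / 2); have k0 : 0 < k by rewrite sqrtr_gt0.
  apply: (@cvg0_le _ _ (fun n => k^-1 * normc (inner (gN n) v))).
    move=> n; rewrite normc_ge0 andTb (ipZl ax) normcM normc_real.
    rewrite ger0_norm ?invr_ge0 ?ip_norm_ge0// ler_wpM2r ?normc_ge0//.
    rewrite lef_pV2 ?posrE//.
    rewrite -(@ler_pXn2r _ 2) ?nnegrE ?ip_norm_ge0 ?(ltW k0)//.
    by rewrite sqr_sqrtr ?(ltW half)//; apply: NP; rewrite /= leq_addl.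
  rewrite -(mulr0 k^-1); apply: cvgMl_tmp.
  by have := weak v; rewrite -(cvg_shiftn N).
(* [hN] competes in the essential concentration, so the gap leaves room for some [r < L]. *)
have [|r rL [M MP]] := @limn_esup_lt_bound _ (fun n => w (hN n)) L.
  apply: le_lt_trans gap; apply: ereal_sup_ubound; exists hN => //.
  by congr limn_esup; apply/funext => n; exact: wE.
have wgN n : (M <= n)%N -> w (gN n) <= r * nm (gN n) ^+ 2.
  move=> Mn; rewrite -ler_pdivrMr ?exprn_gt0//.
  by rewrite mulrC -exprVn -wZ MP.
(* Pass to the limit in [Lle] using [w h <= L t] and [w (g n) <= r |g n|^2]. The shift by [M + N]
   combines the re-indexing of [gN] with the range where [r] is a bound. *)
have : L * (1 - t) - r * (1 - t) <= 0.
  have shift (a : nat -> R) (l : R) : a @ \oo --> l ->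
      (fun n => a (n + (M + N))%N) @ \oo --> l by rewrite -(cvg_shiftn (M + N)).
  have lim : (fun n => r * nm (g n) ^+ 2 + x h (g n) + n.+1%:R^-1) @ \oo -->
      r * (1 - t) + 0 + 0.
    apply: cvgD; last exact: cvg_harmonic.
    by apply: cvgD => //; exact: cvgMl_tmp.
  have := shift _ _ lim; rewrite !addr0 subr_le0 => /cvgr_to_ge.
  apply; apply: nearW => n.
  rewrite mulrBr mulr1 lerBlDl; apply: le_trans (Lle (n + (M + N))%N) _.
  rewrite !addrA !lerD2r lerD//.
  by have := wgN (n + M)%N (leq_addl _ _); rewrite /gN -addnA.
by rewrite -mulrBl pmulr_lle0// subr_le0 leNgt rL.
Qed.

End attainment.

Theorem proposition5p2 (R : realType) (d : nat)
    (S : {linear L2 (@leb R d) -> L2 (@leb R d)}) (p : R)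
    (Omega : set (@phase_space R d))
    (bS : bounded_op S) (p1 : 1 <= p)
    (mOmega : measurable Omega)
    (Omega_gt0 : (0 < phase_measure Omega)%E)
    (Omega_lty : (phase_measure Omega < +oo)%E)
    (gap : (ess_concentration p Omega S < concentration p Omega S)%E) :
  exists f : L2 (@leb R d), f != 0 /\
    quad_rep_norm p Omega S f =
      (concentration p Omega S * (L2norm f ^+ 2)%:E)%E.
Proof.
(* [bounded_op] prescribes no sign for its constant, so the absolute value is used. *)
have [C bC] := bS; have C0 : 0 <= `|C| by [].
have bS' u : ip_norm (@inner _ _ R (@leb R d)) (S u) <=
    `|C| * ip_norm (@inner _ _ R (@leb R d)) u.
  by rewrite (le_trans (bC u))// ler_wpM2r ?ip_norm_ge0 ?ler_norm.
exact: (concentration_attained C0 bS' p1 mOmega Omega_lty gap).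
Qed.
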